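(* Let $X$ be an analytic subset of a complete separable metric space (with the induced metric), let $Y$ be a separable metric space, let $(\Lambda,\mathcal P)$ be a probability space, and let $\pi:\Lambda\times X\to Y$ be a measurable function; write $\pi_\lambda(\cdot)=\pi(\lambda,\cdot)$. Suppose there are positive real numbers $\alpha,\kappa,C$ such that $$\mathcal P\big[\lambda\in\Lambda:\ d(\pi_\lambda(x_1),\pi_\lambda(x_2))\le \delta\, d(x_1,x_2)^\alpha\big]\le C\delta^\kappa$$ for all $\delta>0$ and all $x_1,x_2\in X$ with $x_1\neq x_2$. Then $$\dim \pi_\lambda(X)\ \ge\ \min(\kappa,\ \dim X/\alpha)\qquad\text{for } \mathcal P\text{-a.e. }\lambda\in\Lambda.$$
   Context: $\dim$ denotes Hausdorff dimension, $\dim X=\sup\{s\ge 0:\mathcal H^s(X)>0\}$ (possibly $+\infty$; $\dim\emptyset=0$), where $\mathcal H^s$ is the $s$-dimensional Hausdorff measure. Measurability of $\pi$ is with respect to the product of the $\sigma$-algebra of $\Lambda$ with the Borel $\sigma$-algebra of $X$, and the Borel $\sigma$-algebra of $Y$. ''For a.e. $\lambda$'' means for all $\lambda$ outside some $\mathcal P$-null set. The letter $d$ denotes the metric on $X$ or $Y$. *)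

(* Defs.v *)
From HB Require Import structures.
From mathcomp Require Import all_boot all_order all_algebra.
From mathcomp Require Import all_classical all_reals all_analysis.

Set Implicit Arguments.
Unset Strict Implicit.
Unset Printing Implicit Defensive.

Import Order.TTheory GRing.Theory Num.Theory.

Local Open Scope classical_set_scope.
Local Open Scope ring_scope.

(* The library's completeType and measurableType require a distinguished point.
   The notions below are stated on bare types and topological spaces, so that
   empty spaces are allowed. *)

Definition separable_space (T : topologicalType) : Prop :=
  exists2 D : set T, countable D & dense D.

Definition complete_space (T : uniformType) : Prop :=
  forall F : set_system T, ProperFilter F -> cauchy F -> exists l : T, F --> l.

(* Continuous images of complete separable metric spaces. The empty set is
   analytic because a metricType may be empty. *)
Definition analytic (R : realType) (Z : metricType R) (A : set Z) : Prop :=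
  exists W : metricType R, [/\ complete_space W, separable_space W &
    exists2 f : W -> Z, continuous f & range f = A].

Definition borel (T : topologicalType) : set (set T) := <<s (@open T) >>.

Definition prod_sigma (S T : Type) (G : set (set S)) (H : set (set T)) :
    set (set (S * T)) :=
  <<s [set A `*` B | A in G & B in H] >>.

Definition sigma_measurable (S T : Type) (G : set (set S)) (H : set (set T))
    (f : S -> T) : Prop :=
  forall B : set T, H B -> G (f @^-1` B).

Section hausdorff.
Context {R : realType} {T : metricType R}.
Local Open Scope ereal_scope.

(* The added 0 only matters for E = set0. *)
Definition diam (E : set T) : \bar R :=
  ereal_sup (0 |` [set (mdist p.1 p.2)%:E | p in E `*` E]).

(* diam E ^ s, with the convention that the empty set costs nothing: in the
   library 0 `^ 0 = 1, which is the right value for singletons when s = 0 but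
   not for the empty set. *)
Definition diam_pow (s : R) (E : set T) : \bar R :=
  if `[< E = set0 >] then 0 else poweR (diam E) s.

Definition delta_cover (delta : R) (A : set T) (F : (set T)^nat) : Prop :=
  A `<=` \bigcup_i F i /\ forall i, diam (F i) <= delta%:E.

Definition hausdorff_content (s delta : R) (A : set T) : \bar R :=
  ereal_inf [set \sum_(i <oo) diam_pow s (F i) | F in delta_cover delta A].

Definition hausdorff_measure (s : R) (A : set T) : \bar R :=
  ereal_sup [set hausdorff_content s delta A | delta in [set e : R | (0 < e)%R]].

(* The added 0 only matters for A = set0. *)
Definition hausdorff_dim (A : set T) : \bar R :=
  ereal_sup (0 |` [set s%:E | s in [set s : R | (0 <= s)%R /\
                                      0 < hausdorff_measure s A]]).

End hausdorff.

(* Main.v *)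
Require Import Defs.
From HB Require Import structures.
From mathcomp Require Import all_boot all_order all_algebra.
From mathcomp Require Import all_classical all_reals all_analysis.
From mathcomp Require Import measurable_realfun.
From mathcomp Require Import ring lra zify.

Set Implicit Arguments.
Unset Strict Implicit.
Unset Printing Implicit Defensive.

Import Order.TTheory GRing.Theory Num.Theory.
Import numFieldNormedType.Exports.

Local Open Scope classical_set_scope.
Local Open Scope ring_scope.

(** Let [mu] be a probability measure on [X] with
    [(mu x mu) {d(x, y) < r} <= C r^u], where [alpha t < u < alpha kappa].
    Transversality and Tonelli's theorem bound the average over [lambda] of
    [(mu x mu) {d(pi_lambda x, pi_lambda y) < 2^(-alpha n)}] by a multiple of
    [2^(-u n)]; multiplied by [2^(alpha t n)] this is summable, so for almost
    every [lambda] the image of [mu] has finite [t]-energy and the mass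
    distribution principle gives [H^t(pi_lambda X) > 0].

    It remains to find [mu] when [H^s(X) > 0] for some [s > u], that is, to
    prove Frostman's lemma with a loss in the exponent. Write [X = f(W)] with
    [W] complete and separable, cover [W] by countably many balls of radius
    [2^(-i)] for each [i], and let [W_j] be the set of points lying, for each
    [i < j], in one of the first [b_i] balls of radius [2^(-i)]. The [b_i] can
    be chosen so that the Hausdorff contents of the sets [f(W_j)] are bounded
    below. The point is an increasing sets lemma: up to a constant factor, the
    content of an increasing union is at most the limit of the contents, and no
    loss occurs for covering sets of size bounded below, by a compactness
    argument. At the [j]-th step one only loses a factor at scales below
    [2^(-q j)], and all these factors together amount to a small change of the
    exponent. On a set of positive content, almost minimisers of a truncated
    energy have, by the first-order condition, a large potential at every point
    of the set; covering the set by balls of large mass bounds the energy by the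
    inverse of the content. A limit of these finitely supported measures along
    an ultrafilter exists because of the bounds [b_i], and it is realised as an
    image of Lebesgue measure on [0, 1]. *)

(** * Vitali selection and unordered sums *)

(** A small [k] stands for a large set. Zorn's lemma gives a maximal separated family such that
    whatever is near it is near a member of no larger [k]; an element of [A] near no member, with
    [k] minimal among these, could still be added. *)
Lemma vitali (V : Type) (near : V -> V -> Prop) (k : V -> nat) (A : set V) :
  (forall v, A v -> near v v) -> (forall u v, near u v -> near v u) ->
  exists S : set V, [/\ S `<=` A,
    forall u v, S u -> S v -> near u v -> u = v &
    forall v, A v -> exists2 s, S s & near v s /\ (k s <= k v)%N].
Proof.
move=> nearxx nearC.
pose P (S : set V) := [/\ S `<=` A,
    forall u v, S u -> S v -> near u v -> u = v &
    forall v, A v -> (exists2 s, S s & near v s) ->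
      exists2 s, S s & near v s /\ (k s <= k v)%N].
have [F FP Ftot|S [[SA Sdis Snear] Smax]] := @Zorn_bigcup V P.
  split.
  - by move=> x [X /FP[+ _ _]] => /[apply].
  - move=> u v [X FX Xu] [Y FY Yv].
    have [XY|YX] := Ftot _ _ FX FY.
      by have [_ + _] := FP _ FY; apply => //; exact: XY.
    by have [_ + _] := FP _ FX; apply => //; exact: YX.
  - move=> v Av [s [X FX Xs] vs].
    have [_ _ /(_ _ Av)[|s' Xs' ?]] := FP _ FX; first by exists s.
    by exists s' => //; exists X.
exists S; split => // v Av; apply: (Snear v Av).
apply: contrapT => vS.
pose B := [set n | exists2 u, A u & k u = n /\ ~ exists2 s, S s & near u s].
have [n [[u Au [un uS]] nmin]] : exists n, B n /\ forall m, B m -> (n <= m)%N.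
  have /asboolP Bv : B (k v) by exists v.
  have exB : exists n, `[< B n >] by exists (k v).
  case: (ex_minnP exB) => n /asboolP Bn nmin; exists n; split => // m Bm.
  exact/nmin/asboolP.
apply: (Smax (S `|` [set u])).
  split; first by left.
  by move=> /(_ u (or_intror erefl)) Su; apply: uS; exists u => //; exact: nearxx.
split.
- by move=> x [/SA//|->].
- move=> x y [Sx|->] [Sy|->] // xy; first exact: Sdis.
    by exfalso; apply: uS; exists x => //; exact: nearC.
  by exfalso; apply: uS; exists y.
- move=> x Ax [s Ss xs].
  have [xS|xS] := pselect (exists2 s, S s & near x s).
    by have [s' Ss' ?] := Snear _ Ax xS; exists s' => //; left.
  case: Ss xs => [Ss xs|->xu]; first by exfalso; apply: xS; exists s.
  exists u; [by right|split => //].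
  by rewrite un; apply: nmin; exists x.
Qed.

Section esum_facts.
Context {R : realType}.
Local Open Scope ereal_scope.

Lemma esum_subset (I : choiceType) (A B : set I) (a : I -> \bar R) :
  A `<=` B -> (forall i, B i -> 0 <= a i) ->
  \esum_(i in A) a i <= \esum_(i in B) a i.
Proof.
move=> AB a0; rewrite (esumID A B)// (_ : B `&` A = A).
  by rewrite leeDl// esum_ge0// => i [/a0].
by apply/seteqP; split => [i []|i Ai]//; split => //; exact: AB.
Qed.

Lemma esumU_le (I : choiceType) (A B : set I) (a : I -> \bar R) :
  (forall i, 0 <= a i) ->
  \esum_(i in A `|` B) a i <= \esum_(i in A) a i + \esum_(i in B) a i.
Proof.
move=> a0; rewrite (esumID A (A `|` B))//; apply: leeD.
  by apply: esum_subset => // i [].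
by apply: esum_subset => // i [[]].
Qed.

Lemma esumU (I : choiceType) (A B : set I) (a : I -> \bar R) :
  (forall i, 0 <= a i) -> A `&` B = set0 ->
  \esum_(i in A `|` B) a i = \esum_(i in A) a i + \esum_(i in B) a i.
Proof.
move=> a0 AB; rewrite (esumID A (A `|` B))//.
congr adde; congr esum; apply/seteqP; split => [i|i Ai].
- by case.
- by split => //; left.
- by case=> -[].
- by split; [right|move=> Ai'; have : (A `&` B) i by []; rewrite AB].
Qed.

Lemma esum_image_le (I J : choiceType) (A : set I) (f : I -> J)
    (a : J -> \bar R) : (forall j, 0 <= a j) ->
  \esum_(j in f @` A) a j <= \esum_(i in A) a (f i).
Proof.
move=> a0.
have [[i0 _]|noI] := pselect (exists i : I, A i); last first.
  rewrite (_ : A = set0) ?image_set0 ?esum_set0//.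
  by apply/seteqP; split => // i Ai; apply: noI; exists i.
have /choice [g gP] : forall j, exists i, (f @` A) j -> A i /\ f i = j.
  move=> j; have [[i Ai <-]|nj] := pselect ((f @` A) j); first by exists i.
  by exists i0.
pose A' := g @` (f @` A).
have fA' : f @` A' = f @` A.
  apply/seteqP; split => [_ [_ [j Aj <-] <-]|j Aj].
    by have [_ ->] := gP _ Aj.
  by exists (g j); [exists j|have [_ ->] := gP _ Aj].
rewrite -fA' esum_image.
  by apply: esum_subset => // _ [j Aj <-]; have [] := gP _ Aj.
move=> _ _ /set_mem [j Aj <-] /set_mem [j' Aj' <-].
by have [_ ->] := gP _ Aj; have [_ ->] := gP _ Aj' => ->.
Qed.

End esum_facts.

(** * Hausdorff contents and increasing sets *)

Section content.
Context {R : realType} {T : metricType R}.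
Implicit Types (p q : set T * nat) (U : set (set T * nat)).

Definition rad (k : nat) : R := 2^-1 ^+ k.

Lemma rad_gt0 k : 0 < rad k. Proof. by rewrite exprn_gt0. Qed.

Lemma radS k : rad k.+1 = rad k / 2. Proof. by rewrite /rad exprSr. Qed.

Lemma rad_le j k : (j <= k)%N -> rad k <= rad j.
Proof. by move=> jk; apply: ler_wiXn2l => //; lra. Qed.

Lemma rad_lt j k : (j < k)%N -> rad k <= rad j / 2.
Proof. by move=> jk; rewrite -radS; exact: rad_le. Qed.

Lemma sum_rad m : \sum_(n < m) rad n.+1 = 1 - rad m.
Proof.
elim: m => [|m IH]; first by rewrite big_ord0 /rad expr0 subrr.
by rewrite big_ord_recr/= IH radS; lra.
Qed.

(* A covering set comes with a scale, and is charged by the weight of its scale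
   instead of a power of its diameter. *)
Definition small p := forall x y, p.1 x -> p.1 y -> mdist x y <= rad p.2.

Definition cover (K : nat) (A : set T) U :=
  (forall p, U p -> small p /\ (K <= p.2)%N) /\ A `<=` \bigcup_(p in U) p.1.

Definition cost (w : nat -> R) U : \bar R := \esum_(p in U) (w p.2)%:E.

Definition content (w : nat -> R) (K : nat) (A : set T) : \bar R :=
  ereal_inf [set cost w U | U in cover K A].

Lemma content_le w K A U : cover K A U -> (content w K A <= cost w U)%E.
Proof. by move=> cU; apply: ereal_inf_lbound; exists U. Qed.

Lemma content_ge0 w K A : (forall k, 0 <= w k) -> (0 <= content w K A)%E.
Proof.
move=> w0; apply: le_ereal_inf_tmp => _ [U _ <-].
by apply: esum_ge0 => p _; rewrite lee_fin.
Qed.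

Lemma content_cover w K A (M : R) : (content w K A < M%:E)%E ->
  exists2 U, cover K A U & (cost w U < M%:E)%E.
Proof.
move=> /ereal_inf_lt => -[_ [U cU <-] UM].
by exists U.
Qed.

End content.
Arguments rad {R}.

Section lossy.
Context {R : realType} {T : metricType R}.
Implicit Types (p q : set T * nat).
Local Notation rad := (@rad R).

(** In an index [i], [i.1] is the number of a cover, [i.2.1] a set of that cover and [i.2.2] its
    scale. *)
Let near (i j : nat * (set T * nat)) := exists x y,
  [/\ i.2.1 x, j.2.1 y & mdist x y <= rad i.2.2 + rad j.2.2].

Let nearC i j : near i j -> near j i.
Proof.
by move=> [x [y [ix jy xy]]]; exists y, x; rewrite metric_sym addrC.
Qed.

Variable U : nat -> set (set T * nat).

Let unswallowed i := U i.1 i.2 /\ forall j, (i.1 < j.1)%N -> U j.1 j.2 ->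
  near i j -> (i.2.2 <= j.2.2)%N.

(** Each swallowing moves to a set at least twice as large, so the induction on the scale ends; as
    [rad i.2.2 <= rad j.2.2 / 2], the distances travelled telescope. *)
Let unswallowed_cover i z : U i.1 i.2 -> i.2.1 z -> small i.2 ->
  (forall n p, U n p -> small p) ->
  exists j, [/\ unswallowed j, (j.2.2 <= i.2.2)%N &
    exists2 y, j.2.1 y & mdist z y <= 4 * (rad j.2.2 - rad i.2.2)].
Proof.
move=> + + + Usmall.
elim/ltn_ind : {i}(i.2.2) {-2}i (erefl i.2.2) z => k IH i ik z Ui iz si.
have [ui|nui] := pselect (unswallowed i).
  by exists i; split => //; exists z => //; rewrite mdistxx subrr mulr0.
have [j [ij Uj nij ltji]] : exists j, [/\ (i.1 < j.1)%N, U j.1 j.2, near i j &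
    (j.2.2 < i.2.2)%N].
  apply: contrapT => nj; apply: nui; split => // j ij Uj nij.
  by rewrite leqNgt; apply/negP => ji; apply: nj; exists j.
have [x [y [ix jy xy]]] := nij.
have [|m [um mj [y' my' yy']]] := IH j.2.2 _ j erefl y Uj jy (Usmall _ _ Uj).
  by rewrite -ik.
exists m; split => //; first by rewrite ik in ltji *; lia.
exists y' => //.
have zx := si _ _ iz ix.
have := metric_triangle z x y; have := metric_triangle z y y'.
by have := @rad_lt R _ _ ltji; lra.
Qed.

Lemma lossy_increasing_aux (w : nat -> R) (K : nat) (A : nat -> set T) (M e : R) :
  (forall k, 0 <= w k) -> (4 <= K)%N -> 0 < e ->
  (forall n m, (n <= m)%N -> A n `<=` A m) ->
  (forall n, cover K (A n) (U n)) ->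
  (forall n, (content w K (A n) <= M%:E)%E) ->
  (forall n, (cost w (U n) <= content w K (A n) + (e * rad n.+1)%:E)%E) ->
  exists2 S, cover (K - 4) (\bigcup_n A n) S &
    (cost (fun k => w (k + 4)%N) S <= (M + e)%:E)%E.
Proof.
move=> w0 K4 e0 Amon Ucov AM Uopt.
have Usmall n p : U n p -> small p by move=> Up; have [/(_ _ Up)[]] := Ucov n.
have UK n p : U n p -> (K <= p.2)%N by move=> Up; have [/(_ _ Up)[]] := Ucov n.
have wE0 (p : set T * nat) : (0 <= (w p.2)%:E)%E by rewrite lee_fin.
(* Empty sets are dropped because [near] is reflexive only on nonempty ones. *)
pose V := [set i | unswallowed i /\ exists x, i.2.1 x].
have [| |S [SV Sdis Scov]] := @vitali _ near (fun i => i.2.2) V.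
- move=> i [_ [x ix]]; exists x, x; split => //.
  by rewrite mdistxx addr_ge0// ltW// rad_gt0.
- exact: nearC.
(* A point of the union lies within [4 * rad j.2.2] of an unswallowed [j]; crossing [j] and the gap
   to an [i] of [S] that is no smaller adds at most three radii, whence [7]. Diameters become at
   most [15 * rad i.2.2], below [rad (i.2.2 - 4)]. *)
pose enl (i : nat * (set T * nat)) : set T * nat :=
  ([set z | exists2 y, i.2.1 y & mdist z y <= 7 * rad i.2.2], (i.2.2 - 4)%N).
exists (enl @` S).
  split.
    move=> _ [i Si <-]; have [[Ui _] _] := SV _ Si; split; last first.
      by rewrite /= leq_sub2r// (UK _ _ Ui).
    move=> x y [x' ix' xx'] [y' iy' yy'] /=.
    have -> : rad (i.2.2 - 4) = 16 * rad i.2.2.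
      have iE : i.2.2 = ((i.2.2 - 4).+4)%N by have := UK _ _ Ui; lia.
      by rewrite [in RHS]iE 4!radS; field.
    have := Usmall _ _ Ui _ _ ix' iy'; have := metric_triangle x x' y.
    have := metric_triangle x' y' y; rewrite (metric_sym y' y).
    by have := @rad_gt0 R i.2.2; lra.
  move=> z [n _ Anz]; have [p Up pz] := (Ucov n).2 _ Anz.
  have [j [uj _ [y jy zy]]] :=
    @unswallowed_cover (n, p) z Up pz (Usmall _ _ Up) Usmall.
  have [|i Si [ji ij]] := Scov j; first by split => //; exists y.
  exists (enl i); first by exists i.
  have [x [y' [jx iy' xy']]] := ji.
  exists y' => //; have := Usmall _ _ uj.1 _ _ jy jx.
  have := metric_triangle z y x; have := metric_triangle z x y'.
  have := @rad_le R _ _ ij; have := @rad_gt0 R p.2 => /=.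
  by move: zy => /=; lra.
have wS (i : nat * (set T * nat)) : S i -> (w ((enl i).2 + 4) = w i.2.2).
  by move=> Si; have [[Ui _] _] := SV _ Si; congr w => /=; have := UK _ _ Ui; lia.
apply: (@le_trans _ _ (\esum_(i in S) (w i.2.2)%:E)).
  apply: le_trans (esum_image_le _ _ _) _; first by move=> p; rewrite lee_fin.
  by apply: le_esum => i Si /=; rewrite -wS.
(* Finite subfamilies [X] suffice; [N] will come after all cover numbers in [X]. *)
apply: ge_ereal_sup => _ [X [finX XS] <-].
rewrite -esum_fset//.
have [N XN] : exists N, forall i, X i -> (i.1 < N)%N.
  have /finite_seqP [F XF] := finX.
  exists (\max_(i <- F) i.1).+1 => i; rewrite XF /= => Fi.
  by rewrite ltnS (@leq_bigmax_seq _ F xpredT (fun i => i.1) i).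
pose touch m := [set q | U N q /\ exists i, [/\ X i, (i.1 < m)%N &
  exists x, q.1 x /\ i.2.1 x]].
(* A member of [X] is unswallowed, so whatever touches it in the later cover [U N] is no larger, and
   cannot touch a second member of the separated family [S]. *)
have touchr i q x : X i -> U N q -> q.1 x -> i.2.1 x -> rad q.2 <= rad i.2.2.
  move=> Xi UNq qx ix; apply: rad_le.
  have [[_ /(_ (N, q) (XN _ Xi) UNq) iq] _] := SV _ (XS _ Xi).
  apply: iq; exists x, x; split => //.
  by rewrite mdistxx addr_ge0// ltW// rad_gt0.
have touch_inj i j q x y : X i -> X j -> U N q -> q.1 x -> i.2.1 x ->
    q.1 y -> j.2.1 y -> i = j.
  move=> Xi Xj UNq qx ix qy jy; apply: Sdis; [exact: XS|exact: XS|].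
  exists x, y; split => //; have := Usmall _ _ UNq _ _ qx qy.
  have := touchr _ _ _ Xi UNq qx ix; have := @rad_gt0 R j.2.2; lra.
have fin n : exists c : R, content w K (A n) = c%:E.
  have /ge0_fin_numE : (0 <= content w K (A n))%E by exact: content_ge0.
  rewrite (le_lt_trans (AM n) (ltry _)) => fn.
  by exists (fine (content w K (A n))); rewrite fineK.
pose X_ n := [set p | X (n, p)].
pose W n := [set q | U N q /\ exists p x, [/\ X_ n p, q.1 x & p.1 x]].
(* Replacing [X_ n] by [W n] in [U n] gives another cover of [A n], as [A n] is contained in [A N];
   near-optimality of [U n] compares the two costs. *)
have step n : (n < N)%N -> (cost w (X_ n) <= (e * rad n.+1)%:E + cost w (W n))%E.
  move=> nN.
  have XU : X_ n `<=` U n by move=> p Xp; have [[]] := SV _ (XS _ Xp).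
  have cov : cover K (A n) ((U n `\` X_ n) `|` W n).
    split=> [p [[Up _]|[Up _]]|z Anz].
    - by split; [exact: Usmall Up|exact: UK Up].
    - by split; [exact: Usmall Up|exact: UK Up].
    have [p Up pz] := (Ucov n).2 _ Anz.
    have [Xp|nXp] := pselect (X_ n p); last by exists p => //; left.
    have [q Uq qz] := (Ucov N).2 _ (Amon _ _ (ltnW nN) _ Anz).
    by exists q => //; right; split => //; exists p, z.
  have := content_le w cov.
  have := @esumU_le R _ (U n `\` X_ n) (W n) (fun p => (w p.2)%:E) wE0.
  have := Uopt n; rewrite {1}/cost (esumID (X_ n) (U n))//.
  rewrite setIidr//.
  have [c ->] := fin n; rewrite -/(cost w _) -!/(cost w _) -setDE -!/(cost w _).
  have : (0 <= cost w (X_ n))%E by exact: esum_ge0.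
  have : (0 <= cost w (U n `\` X_ n))%E by exact: esum_ge0.
  have : (0 <= cost w (W n))%E by exact: esum_ge0.
  move: (cost w (X_ n)) (cost w (U n `\` X_ n)) (cost w (W n))
    (cost w (U n `\` X_ n `|` W n)) => [a| |] [b| |] [d| |] [f| |] //=;
    rewrite ?leey//=.
  by rewrite -!EFinD !lee_fin; lra.
(* The sets [W n] are pairwise disjoint, so no member of [U N] pays twice. *)
have main m : (m <= N)%N -> (\esum_(i in X `&` [set i | (i.1 < m)%N]) (w i.2.2)%:E
    <= (\sum_(n < m) e * rad n.+1)%:E + cost w (touch m))%E.
  elim: m => [_|m IH mN].
    rewrite [X in esum X _](_ : _ = set0) ?esum_set0.
      by rewrite big_ord0 add0e; exact: esum_ge0.
    by apply/seteqP; split => i // [].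
  have -> : X `&` [set i | (i.1 < m.+1)%N] =
     (X `&` [set i | (i.1 < m)%N]) `|` (pair m @` X_ m).
    apply/seteqP; split => [[n p] [Xi /=]|i [[Xi /= im]|[p Xp <-]]].
    - rewrite ltnS leq_eqVlt => /orP[/eqP nm|nm]; last by left.
      by right; exists p => //; rewrite /X_ /= -?nm// nm.
    - by split => //=; rewrite ltnW.
    - by split => //=.
  apply: le_trans (esumU_le _ _ _) _; first by move=> i.
  rewrite big_ord_recr/= EFinD.
  have IH' := IH (ltnW mN).
  have st := step m mN.
  have imst : (\esum_(j in [set (m, x) | x in X_ m]) (w j.2.2)%:E <= cost w (X_ m))%E.
    by apply: le_trans (esum_image_le _ _ _) _ => // i.
  have UT : touch m.+1 = touch m `|` W m.
    apply/seteqP; split=> [q [Uq [[n p] [Xi /= im [x [qx ix]]]]]|q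
        [[Uq [i [Xi im]]]|[Uq [p [x [Xp qx px]]]]]].
    - move: im; rewrite ltnS leq_eqVlt => /orP[/eqP nm|nm].
        by right; split => //; exists p, x; split => //; rewrite /X_ /= -nm.
      by left; split => //; exists (n, p); split => //; exists x.
    - by move=> [x ?]; split => //; exists i; split => //; [rewrite ltnW|exists x].
    - by split => //; exists (m, p); split => //; exists x.
  have TW : touch m `&` W m = set0.
    apply/seteqP; split => // q [[Uq [i [Xi im [x [qx ix]]]]] [_ [p [y [Xp qy py]]]]].
    have ij := @touch_inj i (m, p) q x y Xi Xp Uq qx ix qy py.
    by rewrite ij /= ltnn in im.
  rewrite UT /cost esumU// -!/(cost w _).
  apply: le_trans (leeD IH' (le_trans imst st)) _.
  by rewrite addeACA.
have -> : X = X `&` [set i | (i.1 < N)%N].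
  by apply/seteqP; split => [i Xi|i []//]; split => //; exact: XN.
(* The errors of the covers [0] to [N] add up to [e * (1 - rad N.+1)]. *)
apply: le_trans (main N (leqnn _)) _.
have tU : (cost w (touch N) <= cost w (U N))%E by apply: esum_subset => // q [].
apply: le_trans (leeD2l _ (le_trans tU (Uopt N))) _.
apply: le_trans (leeD2l _ (leeD2r _ (AM N))) _.
rewrite -!EFinD lee_fin.
have := @sum_rad R N.+1; rewrite big_ord_recr/= -mulr_sumr => sr.
have : 0 < e * rad N.+1 by rewrite mulr_gt0// rad_gt0.
have : e * (\sum_(i < N) rad i.+1 + rad N.+1) = e * (1 - rad N.+1) by rewrite sr.
lra.
Qed.

End lossy.

(* Take covers [U n] of the [A n] that are optimal up to summable errors. A set
   of [U n] is swallowed if some later cover contains a larger set near it;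
   chains of swallowings are finite, so the unswallowed sets, enlarged, cover
   the union. Let [S] be a Vitali subfamily of the unswallowed sets. The sets of
   a late cover [U N] that touch a set [p] of [S] are smaller than [p], hence
   touch no other set of [S]; exchanging, in [U n], its members in [S] for the
   sets of [U N] touching them bounds the weight of [S] by that of [U N]. The
   loss is thus only in the enlargement, which shifts the scales by [4]. *)
Lemma lossy_increasing {R : realType} {T : metricType R} (w : nat -> R) (K : nat)
    (A : nat -> set T) (M e : R) :
  (forall k, 0 <= w k) -> (4 <= K)%N -> 0 < e ->
  (forall n m, (n <= m)%N -> A n `<=` A m) ->
  (forall n, (content w K (A n) <= M%:E)%E) ->
  exists2 S, cover (K - 4) (\bigcup_n A n) S &
    (cost (fun k => w (k + 4)%N) S <= (M + e)%:E)%E.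
Proof.
move=> w0 K4 e0 Amon AM.
have /choice [U UP] : forall n, exists U, cover K (A n) U /\
    (cost w U <= content w K (A n) + (e * rad n.+1)%:E)%E.
  move=> n; have en : 0 < e * rad n.+1 by rewrite mulr_gt0// rad_gt0.
  have /ge0_fin_numE : (0 <= content w K (A n))%E by exact: content_ge0.
  rewrite (le_lt_trans (AM n) (ltry _)) => fn.
  have [|U cU /ltW UM] :=
    @content_cover _ _ w K (A n) (fine (content w K (A n)) + e * rad n.+1).
    by rewrite EFinD fineK// lteDl// lte_fin.
  by exists U; split => //; rewrite EFinD fineK in UM.
by apply: (@lossy_increasing_aux _ _ U) => // n; have [] := UP n.
Qed.

Lemma rad_small {R : realType} (e : R) : 0 < e -> exists k, rad k < e.
Proof.
move=> e0; have radk k : rad k * (k.+1)%:R <= 1 :> R.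
  elim: k => [|k IH]; first by rewrite /rad expr0 mulr1.
  have r1 : rad k <= 1 :> R by have := @rad_le R 0 k isT; rewrite [rad 0]expr0.
  rewrite radS -[k.+2%:R]natr1 mulrDr mulr1 mulrAC.
  by move: (rad k * _) IH => x IH; lra.
exists (Num.bound e^-1).
have := archi_boundP (ltW (_ : 0 < e^-1)); rewrite invr_gt0 => /(_ e0) eb.
have := radk (Num.bound e^-1); rewrite -natr1.
have := @rad_gt0 R (Num.bound e^-1); have := ler0n R (Num.bound e^-1).
have : 1 < e * (Num.bound e^-1)%:R by rewrite mulrC -ltr_pdivrMr// mul1r.
move=> eb1 b0 r0 rb1; rewrite ltNge; apply/negP => er.
by have := ler_wpM2r b0 er; move: rb1 eb1; rewrite mulrDr mulr1; lra.
Qed.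

(** The cells are the balls of dyadic radius about the points of a countable dense set, numbered by
    [pickle]. *)
Lemma small_cells {R : realType} {T : metricType R} : separable_space T ->
  exists V : nat -> set T, forall x (e : R), 0 < e ->
    exists q, V q x /\ forall y z, V q y -> V q z -> mdist y z < e.
Proof.
move=> [D /countable_injP [f finj] Ddense].
pose V q : set T := let ab := odflt (0%N, 0%N) (unpickle q) in
  [set x | exists d, [/\ D d, f d = ab.1 & mdist d x < rad ab.2]].
exists V => x e e0; have [k ke] := @rad_small R (e / 2) ltac:(lra).
have [|y [/interior_subset xy Dy]] := Ddense (ball x (rad k))^° _ (open_interior _).
  by exists x; apply: nbhsx_ballx; exact: rad_gt0.
rewrite ballEmdist/= in xy.
exists (pickle (f y, k)); rewrite /V pickleK/=; split.
  by exists y; split => //; rewrite metric_sym.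
move=> a b [c [Dc fc ca]] [c' [Dc' fc' cb]].
have cy : c = y by apply: finj; rewrite ?inE.
have cy' : c' = y by apply: finj; rewrite ?inE.
subst c c'; have := metric_triangle a y b; rewrite (metric_sym a y); lra.
Qed.

Lemma esum_seq {R : realType} (I : choiceType) (s : seq I) (a : I -> R) :
  uniq s -> (forall i, 0 <= a i) ->
  \esum_(i in [set` s]) (a i)%:E = (\sum_(i <- s) a i)%:E.
Proof.
move=> us a0; rewrite esum_fset//; first by rewrite -fsbig_seq// sumEFin.
by move=> i _; rewrite lee_fin.
Qed.

Lemma ultra_finType (I : Type) (F : set_system I) (J : finType) (f : I -> J) :
  UltraFilter F -> exists j, F [set i | f i = j].
Proof.
move=> UF; apply: contrapT => nj.
have Fn j : F [set i | f i <> j].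
  by have [Fj|//] := in_ultra_setVsetC [set i | f i = j] UF; case: nj; exists j.
suff /(_ (enum J)) : forall s : seq J, F [set i | f i \notin s].
  move=> Fe; have [i /=] := filter_ex Fe; by rewrite mem_enum.
elim => [|j s IH]; first by apply: filterS filterT => i.
apply: filterS (filterI (Fn j) IH) => i [/= fij fis].
by rewrite inE negb_or fis andbT; apply/eqP.
Qed.

(** * Increasing sets: no loss at large scales *)

Section mixed.
Context {R : realType} {T : metricType R}.
Variables (w w' : nat -> R) (K : nat).
Hypothesis w_gt0 : forall k, 0 < w k.
Hypothesis w_large : forall k, (k < K)%N -> w k <= w' k.
Hypothesis w'_gt0 : forall k, 0 < w' k.

(** A set of scale below [K] costs at least the minimum [c] of finitely many positive weights, so
    about [M / c] of them fit, whatever the cover. *)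
Lemma large_entries (M : R) :
  exists N, forall U, (cost w' U <= M%:E)%E ->
  exists s, [/\ uniq s, U `&` [set p : set T * nat | (p.2 < K)%N] = [set` s] &
    (size s <= N)%N].
Proof.
have [c c0 cw] : exists2 c, 0 < c & forall k, (k < K)%N -> c <= w' k.
  elim: K => [|k [c c0 ck]]; first by exists 1.
  exists (Num.min c (w' k)); first by rewrite lt_min c0 w'_gt0.
  move=> i; rewrite ltnS leq_eqVlt => /orP[/eqP ->|/ck ci].
    by rewrite ge_min lexx orbT.
  by rewrite ge_min ci.
exists (Num.bound (M / c)) => U UM.
have main (s : seq (set T * nat)) : uniq s ->
    [set` s] `<=` U `&` [set p | (p.2 < K)%N] -> (size s <= Num.bound (M / c))%N.
  move=> us sU.
  have : (cost w' [set` s] <= M%:E)%E.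
    apply: le_trans UM; apply: esum_subset => p => [/sU[]//|_].
    by rewrite lee_fin ltW.
  rewrite /cost esum_seq// => [|p]; last by rewrite ltW.
  rewrite lee_fin => sM.
  have sMc : (size s)%:R <= M / c.
    rewrite ler_pdivlMr// mulrC; apply: le_trans sM.
    have <- : \sum_(i <- s) c = c * (size s)%:R.
      by rewrite big_const_seq count_predT iter_addr_0 mulr_natr.
    rewrite big_seq [leRHS]big_seq ler_sum// => p ps.
    by apply: cw; have [] := sU _ ps.
  have := archi_boundP (le_trans (ler0n _ _) sMc) => /(le_lt_trans sMc).
  by rewrite ltr_nat => /ltnW.
have [fin|inf] := pselect (finite_set (U `&` [set p | (p.2 < K)%N])).
  have [s Us] := (finite_seqP _).1 fin.
  exists (undup s); split; first exact: undup_uniq.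
    by rewrite Us; apply/seteqP; split => p /=; rewrite mem_undup.
  by apply: main; [exact: undup_uniq|rewrite Us => p /=; rewrite mem_undup].
have [B BU] := infinite_set_fset (Num.bound (M / c)).+1 inf.
by move=> /leq_trans/(_ (main _ (finmap.fset_uniq B) BU)); rewrite ltnn.
Qed.

Hypothesis K_ge4 : (4 <= K)%N.
Hypothesis w_small : forall k, (K <= k)%N -> w (k - 4) <= w' k.
Hypothesis Tsep : separable_space T.

(* The sets of size at least [rad K] of near-optimal covers of the [A n] are
   boundedly many, and converge along a subsequence (in the sense of Kuratowski)
   without loss; what the limit sets miss is eventually covered by the smaller
   sets, to which [lossy_increasing] applies. *)
Lemma content_increasing (A : nat -> set T) (M : R) :
  (forall n m, (n <= m)%N -> A n `<=` A m) ->
  (forall n, (content w' 0 (A n) <= M%:E)%E) ->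
  (content w 0 (\bigcup_n A n) <= M%:E)%E.
Proof.
move=> Amon AM.
have w0 k : 0 <= w k by exact: ltW.
have w'0 k : 0 <= w' k by exact: ltW.
suff main (e : R) : 0 < e -> (content w 0 (\bigcup_n A n) <= (M + e + e)%:E)%E.
  apply/lee_addgt0Pr => e e0; have := main (e / 2) ltac:(lra).
  by rewrite -EFinD -addrA -splitr.
move=> e0.
have /choice [U UP] : forall n, exists U, cover 0 (A n) U /\
    (cost w' U <= (M + e)%:E)%E.
  move=> n; have [|U cU /ltW UM] := @content_cover _ _ w' 0 (A n) (M + e).
    by apply: le_lt_trans (AM n) _; rewrite lte_fin ltrDl.
  by exists U.
have [N NP] := @large_entries (M + e).
have /choice [s sP] := fun n => NP (U n) (UP n).2.
(* Short lists are padded with an entry of scale [K]; a scale below [K] thus marks the genuine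
   entries. *)
pose E n (j : 'I_N) := nth (set0, K) (s n) j.
have EU n j : ((E n j).2 < K)%N -> U n (E n j).
  rewrite /E; have [js _|js] := ltnP j (size (s n)); last first.
    by rewrite nth_default//= ltnn.
  have : [set` s n] (nth (set0, K) (s n) j) by apply: mem_nth.
  by have [_ <- _] := sP n; case.
have EK n j : ((E n j).2 <= K)%N.
  rewrite /E; have [js|js] := ltnP j (size (s n)); last by rewrite nth_default.
  have : [set` s n] (nth (set0, K) (s n) j) by apply: mem_nth.
  by have [_ <- _] := sP n; case=> _ /ltnW.
have UE n p : U n p -> (p.2 < K)%N -> exists j, p = E n j.
  move=> Up pK; have [_ + sN] := sP n.
  move=> /seteqP [/(_ p (conj Up pK)) /= ps _].
  have idx : (index p (s n) < N)%N by apply: leq_trans sN; rewrite index_mem.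
  by exists (Ordinal idx); rewrite /E /= nth_index.
have [F [UF Foo]] := ultraFilterLemma (F := \oo) _.
have PF : ProperFilter F := ultra_proper.
have [kap Fkap] := @ultra_finType nat F _
  (fun n => [ffun j => inord (E n j).2 : 'I_K.+1]) UF.
pose kp j : nat := kap j.
have Ekp n j : [ffun j => inord (E n j).2 : 'I_K.+1] = kap -> (E n j).2 = kp j.
  by rewrite /kp => <-; rewrite ffunE inordK// ltnS EK.
have [V VP] := small_cells Tsep.
pose meets q n j := exists y, V q y /\ (E n j).1 y.
pose lim (j : 'I_N) := [set x | forall q, V q x -> F [set n | meets q n j]].
pose c := \sum_(j < N | (kp j < K)%N) w' (kp j).
(* Diagonal choice over the countably many cells: at [n_ i] the scales are the limiting ones, and
   none of the first [i] cells meets the [j]-th set unless it does so for [F]-almost all indices. *)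
have [n_ nP] : exists n_ : nat -> nat, forall i,
    [/\ [ffun j => inord (E (n_ i) j).2 : 'I_K.+1] = kap, (i <= n_ i)%N &
    forall q j, (q < i)%N -> ~ F [set n | meets q n j] -> ~ meets q (n_ i) j].
  pose G i := [set n | [/\ [ffun j => inord (E n j).2 : 'I_K.+1] = kap, (i <= n)%N &
    forall q j, (q < i)%N -> ~ F [set n | meets q n j] -> ~ meets q n j]].
  suff /choice [n_ nG] : forall i, exists n, G i n by exists n_.
  suff FG i : F (G i) by move=> i; exact: filter_ex (FG i).
  elim: i => [|i IH]; first by apply: filterS Fkap => n.
  have Fi : F [set n | (i < n)%N] by apply: Foo; exists i.+1.
  have Fm : F [set n | forall j, ~ F [set n | meets i n j] -> ~ meets i n j].
    suff Fm j : F [set n | ~ F [set n | meets i n j] -> ~ meets i n j].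
      exact: filter_forall Fm.
    have [Fj|Fj] := in_ultra_setVsetC [set n | meets i n j] UF.
      by apply: filterE => n [].
    by apply: filterS Fj => n nm _; exact: nm.
  apply: filterS (filterI IH (filterI Fi Fm)) => n [[nk _ nq] [/= ni nm]].
  split => // q j; rewrite ltnS leq_eqVlt => /orP[/eqP ->|]; [exact: nm|exact: nq].
pose S n := U n `&` [set p | (K <= p.2)%N].
(* The entries of scale below [K] have the limiting scales, so they cost exactly [c]. *)
have cS i : (cost w' (S (n_ i)) <= (M + e - c)%:E)%E.
  set n := n_ i; have [nk _ _] := nP i.
  have := (UP n).2; rewrite /cost (esumID [set p | (p.2 < K)%N])//; last first.
    by move=> p _; rewrite lee_fin.
  have [us -> sN] := sP n; rewrite esum_seq//.
  have -> : U n `&` ~` [set p | (p.2 < K)%N] = S n.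
    rewrite /S; congr (_ `&` _); apply/seteqP; split => p /= => [/negP|Kp].
      by rewrite -leqNgt.
    by apply/negP; rewrite -leqNgt.
  have -> : \sum_(p <- s n) w' p.2 = c.
    rewrite /c (big_nth (set0, K)).
    transitivity (\sum_(0 <= j < N | ((nth (set0, K) (s n) j).2 < K)%N)
        w' (nth (set0, K) (s n) j).2).
      rewrite (big_cat_nat (leq0n _) sN)/= [X in _ = _ + X]big_nat_cond.
      rewrite [X in _ = _ + X]big1 ?addr0; last first.
        by move=> j /andP[/andP[js _]]; rewrite nth_default//= ltnn.
      rewrite big_nat [RHS]big_nat_cond; apply: eq_bigl => j /=.
      case: (ltnP j (size (s n))) => //= js.
      have : [set` s n] (nth (set0, K) (s n) j) by apply: mem_nth.
      by have [_ <- _] := sP n; case=> _ /= ->.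
    rewrite big_mkord; apply: eq_big => j /=; first by rewrite -(Ekp _ _ nk).
    by rewrite -(Ekp _ _ nk).
  rewrite /cost; case: (esum _ _) => [x| |].
  - by rewrite -EFinD !lee_fin; lra.
  - by rewrite addey// leye_eq.
  - by move=> _; exact: leNye.
pose A' := (\bigcup_n A n) `\` \bigcup_(j in [set j | (kp j < K)%N]) lim j.
(* A point of [A'] has, for each [j], a cell that misses the [j]-th set from some [n_ i] on; from
   then on only small sets can cover it. *)
pose B i := [set x | A' x /\ forall i', (i <= i')%N ->
  exists2 p, S (n_ i') p & p.1 x].
have A'B : A' `<=` \bigcup_i B i.
  move=> x [[n0 _ An0] nx].
  have /choice [q qP] : forall j, exists q, (kp j < K)%N ->
      V q x /\ ~ F [set n | meets q n j].
    move=> j; have [jK|jK] := pselect (kp j < K)%N; last by exists 0%N.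
    apply: contrapT => nq; apply: nx; exists j => // q Vq.
    by apply: contrapT => nF; apply: nq; exists q.
  exists (maxn n0 (\max_j q j).+1) => //; split.
    by split => //; exists n0.
  move=> i; rewrite geq_max => /andP[n0i qi].
  have [nk ini nq] := nP i.
  have [p Up px] := (UP (n_ i)).1.2 x (Amon _ _ (leq_trans n0i ini) _ An0).
  exists p => //; split => //=; rewrite leqNgt; apply/negP => pK.
  have [j pE] := UE _ _ Up pK.
  have jK : (kp j < K)%N by rewrite -(Ekp _ _ nk) -pE.
  have [Vx nF] := qP _ jK.
  apply: (nq (q j) j) => //; last by exists x; rewrite -pE.
  by apply: leq_trans qi; rewrite ltnS (leq_bigmax j).
have [|n|S' [S'1 S'2] S'c] := @lossy_increasing R T w' K B (M + e - c) e w'0 K_ge4 e0.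
- by move=> n m nm x [A'x Bx]; split => // i /(leq_trans nm); exact: Bx.
- apply: le_trans (cS n); apply: content_le; split.
    by move=> p [Up pK]; split => //; have [/(_ _ Up)[]] := (UP (n_ n)).1.
  by move=> x [A'x /(_ n (leqnn _))].
pose E' := (fun j => (lim j, kp j)) @` [set j | (kp j < K)%N].
have cov : cover 0 (\bigcup_n A n) (E' `|` S').
  split=> [p [[j jK <-]|/S'1 []//]|x Ax].
    split=> // x y /= limx limy.
    apply/ler_addgt0Pr => d d0.
    have [q [Vx Vq]] := VP x (d / 2) ltac:(lra).
    have [r [Vy Vr]] := VP y (d / 2) ltac:(lra).
    have [n [[[x' [Vx' Ex']] [y' [Vy' Ey']]] /= nk]] :=
      filter_ex (filterI (filterI (limx _ Vx) (limy _ Vy)) Fkap).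
    have En := Ekp n j nk.
    have UEn : U n (E n j) by apply: EU; rewrite En; exact: jK.
    have [sE _] := (UP n).1.1 _ UEn.
    have := sE _ _ Ex' Ey'; rewrite En.
    have := Vq _ _ Vx Vx'; have := Vr _ _ Vy' Vy.
    by have := metric_triangle x x' y; have := metric_triangle x' y' y; lra.
  have [[j jK xj]|nx] := pselect ((\bigcup_(j in [set j | (kp j < K)%N]) lim j) x).
    by exists (lim j, kp j) => //; left; exists j.
  have [p S'p px] := S'2 x (A'B x (conj Ax nx)).
  by exists p => //; right.
apply: le_trans (content_le _ cov) _.
apply: le_trans (esumU_le _ _ _) _; first by move=> p; rewrite lee_fin.
have -> : M + e + e = c + (M + e - c + e) by lra.
rewrite EFinD; apply: leeD.
  apply: le_trans (esum_image_le _ _ _) _; first by move=> p; rewrite lee_fin.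
  have -> : [set j | (kp j < K)%N] = [set` [seq j <- enum 'I_N | (kp j < K)%N]].
    by apply/seteqP; split => j /=; rewrite mem_filter mem_enum andbT.
  rewrite esum_seq//; last exact: (filter_uniq _ (enum_uniq _)).
  rewrite big_filter lee_fin /c big_enum_cond/=.
  by apply: ler_sum => j jK; exact: w_large.
apply: le_trans S'c; apply: le_esum => p S'p; rewrite lee_fin.
have := w_small (k := p.2 + 4); rewrite addnK; apply.
by have [_] := S'1 _ S'p; rewrite leq_subLR addnC.
Qed.

End mixed.

(** * Geometric weights *)

Section weights.
Context {R : realType}.

(** This is [rad k] to the power [s]; negative exponents give the inverse weights. *)
Definition wt (s : R) (k : nat) : R := 2 `^ (- (s * k%:R)).

Lemma wt_gt0 s k : 0 < wt s k. Proof. by rewrite powR_gt0. Qed.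

Lemma wt0 s : wt s 0 = 1. Proof. by rewrite /wt mulr0 oppr0 powRr0. Qed.

Lemma wtS s k : wt s k.+1 = wt s k * wt s 1.
Proof.
rewrite /wt -powRD; last by apply/implyP => _; rewrite pnatr_eq0.
by rewrite -natr1; congr powR; ring.
Qed.

Lemma wtD s t k : wt (s + t) k = wt s k * wt t k.
Proof.
rewrite /wt -powRD; last by apply/implyP => _; rewrite pnatr_eq0.
by congr powR; ring.
Qed.

Lemma wtN s k : wt (- s) k * wt s k = 1.
Proof. by rewrite -wtD addNr /wt mul0r oppr0 powRr0. Qed.

Lemma wt_lt1 (s : R) : 0 < s -> wt s 1 < 1.
Proof.
move=> s0; rewrite /wt mulr1 powRN invf_lt1 ?powR_gt0//.
have : 1 `^ s < 2 `^ s :> R by rewrite gt0_ltr_powR// ?nnegrE// ltr1n.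
by rewrite powR1.
Qed.

Lemma wtE s k : wt s k = wt s 1 ^+ k.
Proof. by elim: k => [|k IH]; rewrite ?wt0 ?expr0// wtS IH exprSr. Qed.

Lemma wt_sum (s : R) m : 0 < s -> \sum_(k < m) wt s k <= (1 - wt s 1)^-1.
Proof.
move=> s0; have w1 := wt_lt1 s0; have w0 := wt_gt0 s 1.
rewrite -div1r ler_pdivlMr ?subr_gt0//.
suff -> : (\sum_(k < m) wt s k) * (1 - wt s 1) = 1 - wt s m.
  by have := wt_gt0 s m; lra.
elim: m => [|m IH]; first by rewrite big_ord0 wt0; ring.
by rewrite big_ord_recr/= mulrDl IH (wtS s m); ring.
Qed.

Lemma wt_rad s k : rad k `^ s = wt s k.
Proof.
rewrite /rad -powR_mulrn; last lra.
by rewrite -powR_inv1// -!powRrM /wt; congr powR; ring.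
Qed.


End weights.

Lemma le_content_weight {R : realType} {T : metricType R} (w w' : nat -> R)
    (K : nat) (A : set T) :
  (forall k, w k <= w' k) -> (content w K A <= content w' K A)%E.
Proof.
move=> ww'; apply: le_ereal_inf_tmp => _ [U cU <-].
apply: le_trans (content_le w cU) _.
by apply: le_esum => p _; rewrite lee_fin.
Qed.

(** * Sets of bounded addresses with large content *)

Section selection.
Context {R : realType} {Z : metricType R}.
Variables (W : Type) (f : W -> Z) (adr : nat -> W -> nat).

(** The weight [wt s k] with one factor [2 ^ (4 s)] for each of the first [j] positive multiples of
    [q] that do not exceed [k]. *)
Let step_weight (s : R) (q j k : nat) : R :=
  2 `^ (4 * s * (minn j (k %/ q))%:R - s * k%:R).

(* The factors [2 ^ (4 s)] lost at the successive scales [q j] are absorbed by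
   the decrease of the exponent from [s] to [t]. *)
Lemma content_selection (s t a : R) : separable_space Z -> 0 < t -> t < s ->
  (a%:E < content (wt s) 0 (range f))%E ->
  exists b : nat -> nat, forall j, (a%:E <= content (wt t) 0
    (f @` [set x | forall i, (i < j)%N -> (adr i x <= b i)%N]))%E.
Proof.
move=> Zsep t0 ts af.
have s0 : 0 < s by lra.
(* With [4 s <= (s - t) q], the at most [k / q] factors [2 ^ (4 s)] at scale [k] amount to at most
   [2 ^ ((s - t) k)]; [4 <= q] is for the shift of scales by [4]. *)
pose q := maxn 4 (Num.bound (4 * s / (s - t))).
have q4 : (4 <= q)%N by rewrite leq_maxl.
have qs : 4 * s <= (s - t) * q%:R.
  rewrite [leRHS]mulrC -ler_pdivrMr ?subr_gt0//; apply: (@le_trans _ _ (Num.bound (4 * s / (s - t)))%:R).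
    by apply/ltW/archi_boundP; rewrite divr_ge0//; lra.
  by rewrite ler_nat leq_maxr.
have le2 (x y : R) : x <= y -> 2 `^ x <= 2 `^ y by apply: ler_powR; lra.
pose v := step_weight s q.
have v0 j k : 0 < v j k by rewrite powR_gt0.
pose Ws (l : seq nat) := [set x | forall i, (i < size l)%N -> (adr i x <= nth 0%N l i)%N].
have Wrcons l n : Ws (rcons l n) = Ws l `&` [set x | (adr (size l) x <= n)%N].
  apply/seteqP; split => [x lx|x [lx xn] i].
    split => [i il|/=].
      by have := lx i; rewrite size_rcons nth_rcons il ltnS ltnW//; apply.
    by have := lx (size l); rewrite size_rcons nth_rcons ltnn eqxx; apply.
  rewrite size_rcons nth_rcons ltnS leq_eqVlt => /orP[/eqP ->|il].
    by rewrite ltnn eqxx.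
  by rewrite il; exact: lx.
pose ok l := (a%:E < content (v (size l)) 0 (f @` Ws l))%E.
have /choice [g gP] : forall l, exists n, ok l -> ok (rcons l n).
  move=> l; have [okl|nokl] := pselect (ok l); last first.
    by exists 0%N => okl; case: (nokl okl).
  (* If every bound [n] failed, [content_increasing] with threshold [q * (size l).+1] would
     contradict [ok l]: the two weights agree below the threshold, and beyond it the new one has
     gained a factor [2 ^ (4 s)]. *)
  apply: contrapT => nn; move: okl; apply/negP; rewrite -leNgt.
  have -> : f @` Ws l = \bigcup_n f @` Ws (rcons l n).
    apply/seteqP; split => [_ [x lx <-]|_ [n _ [x +] <-]].
      exists (adr (size l) x) => //; exists x => //; rewrite Wrcons.
      by split => //=.
    by rewrite Wrcons => -[lx _]; exists x.
  apply: (@content_increasing _ _ _ (v (size l).+1) (q * (size l).+1)%N) => //.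
  - move=> k kq; apply: le2; rewrite lerD2r.
    rewrite ler_wpM2l ?mulr_ge0//; [lra|].
    by rewrite ler_nat leq_min geq_minr andbT geq_min leqnSn.
  - nia.
  - move=> k qk; apply: le2.
    have -> : minn (size l).+1 (k %/ q) = (size l).+1.
      by apply/minn_idPl; rewrite leq_divRL 1?mulnC//; lia.
    have : (minn (size l) ((k - 4) %/ q))%:R <= (size l)%:R :> R.
      by rewrite ler_nat geq_minl.
    rewrite natrB; last by nia.
    rewrite -natr1 => ml; have := ler_wpM2l (ltW s0) ml; lra.
  - move=> n m nm _ [x + <-]; rewrite Wrcons => -[lx xn]; exists x => //.
    by rewrite Wrcons; split => //=; exact: leq_trans nm.
  - move=> n; rewrite leNgt; apply/negP => an; apply: nn; exists n.
    by move=> _; rewrite /ok size_rcons; exact: an.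
pose st := fix st j := if j is j'.+1 then rcons (st j') (g (st j')) else [::].
exists (fun i => g (st i)) => j.
have sst i : size (st i) = i by elim: i => //= i IH; rewrite size_rcons IH.
have nst : forall i, (i < j)%N -> nth 0%N (st j) i = g (st i).
  elim: j => // j IH i; rewrite ltnS /= nth_rcons sst leq_eqVlt => /orP[/eqP ->|ij].
    by rewrite ltnn eqxx.
  by rewrite ij IH.
have okst : ok (st j).
  elim: j {nst} => [|j IH /=]; last exact: gP.
  rewrite /ok /= (_ : Ws [::] = setT); last by apply/seteqP; split.
  rewrite (_ : v 0%N = wt s)//; apply/funext => k.
  by rewrite /v /step_weight min0n mulr0 add0r.
have -> : [set x | forall i, (i < j)%N -> (adr i x <= g (st i))%N] = Ws (st j).
  apply/seteqP; split => x jx i.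
    by rewrite sst => ij; rewrite nst//; exact: jx.
  by move=> ij; rewrite -nst//; apply: jx; rewrite sst.
move: okst; rewrite /ok sst => /ltW/le_trans; apply.
apply: le_content_weight => k; apply: le2.
have kq : (minn j (k %/ q))%:R * q%:R <= k%:R :> R.
  by rewrite -natrM ler_nat (leq_trans _ (leq_trunc_div k q))// leq_mul2r geq_minr orbT.
have := ler_wpM2r (ler0n R (minn j (k %/ q))) qs.
have : 0 <= s - t by lra.
by move=> /ler_wpM2l => /(_ _ _ kq); lra.
Qed.

End selection.

(** * Energy *)

Lemma sum_indic_le1 {R : realType} (I : eqType) (s : seq I) (P : pred I) :
  uniq s -> (forall i j, i \in s -> j \in s -> P i -> P j -> i = j) ->
  \sum_(i <- s) (P i)%:R <= 1 :> R.
Proof.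
elim: s => [|i s IH]; first by rewrite big_nil ler01.
rewrite big_cons /= => /andP[iNs us] Pu; have [Pi|nPi] := boolP (P i); last first.
  by rewrite add0r IH// => j k js ks; apply: Pu; rewrite inE ?js ?ks orbT.
rewrite big_seq big1 ?addr0// => j js; have [Pj|//] := boolP (P j).
by move: iNs; rewrite (Pu i j) ?js// inE ?eqxx// js orbT.
Qed.

Section energy.
Context {R : realType} {T : metricType R}.
Implicit Types (A : set T) (nu : seq (R * T)).

(* A finitely supported measure is a list of pairs (mass, point). *)
Definition probs A : set (seq (R * T)) :=
  [set nu : seq (R * T) | (forall p, p \in nu -> 0 <= p.1 /\ A p.2) /\ \sum_(p <- nu) p.1 = 1].

(* The shift by [2] is chosen for balls of radius [2 * rad k.+2] to have scale
   [k]. *)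
Definition close (k : nat) (x y : T) : R := (mdist x y < rad k.+2)%R%:R.

Definition pair_mass nu (k : nat) : R :=
  \sum_(p <- nu) \sum_(q <- nu) p.1 * q.1 * close k p.2 q.2.

(** A truncated dyadic form of the Riesz kernel [d(x, y) ^ (- t)]; [form] and [pot] are the energy
    and the potential for a kernel. *)
Let kern (t : R) (m : nat) x y := \sum_(k < m) wt (- t) k * close k x y.

Let form (K : T -> T -> R) nu := \sum_(p <- nu) \sum_(q <- nu) p.1 * q.1 * K p.2 q.2.

Let pot (K : T -> T -> R) nu x := \sum_(p <- nu) p.1 * K x p.2.

Let close_ge0 k x y : 0 <= close k x y. Proof. by rewrite /close ler0n. Qed.

Let kern_ge0 t m x y : 0 <= kern t m x y.
Proof. by apply: sumr_ge0 => k _; rewrite mulr_ge0// ltW// wt_gt0. Qed.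

Let kernC t m x y : kern t m x y = kern t m y x.
Proof. by apply: eq_bigr => k _; rewrite /close metric_sym. Qed.

Let kernxx t m x : kern t m x x = \sum_(k < m) wt (- t) k.
Proof. by apply: eq_bigr => k _; rewrite /close mdistxx rad_gt0 mulr1. Qed.

Let form_mix K nu x (h : R) : (forall x y, K x y = K y x) ->
  form K ((h, x) :: [seq ((1 - h) * p.1, p.2) | p <- nu]) =
  h ^+ 2 * K x x + 2 * h * (1 - h) * pot K nu x + (1 - h) ^+ 2 * form K nu.
Proof.
move=> KC; rewrite /form /pot big_cons big_map big_cons big_map /=.
under [X in _ + X = _]eq_bigr do rewrite big_cons big_map /=.
rewrite big_split/= !mulr_sumr.
have -> : \sum_(i <- nu) h * ((1 - h) * i.1) * K x i.2 =
    h * (1 - h) * \sum_(i <- nu) i.1 * K x i.2.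
  by rewrite mulr_sumr; apply: eq_bigr => i _; ring.
have -> : \sum_(i <- nu) (1 - h) * i.1 * h * K i.2 x =
    h * (1 - h) * \sum_(i <- nu) i.1 * K x i.2.
  by rewrite mulr_sumr; apply: eq_bigr => i _; rewrite KC; ring.
have -> : \sum_(i <- nu) \sum_(j <- nu) (1 - h) * i.1 * ((1 - h) * j.1) * K i.2 j.2 =
    \sum_(i <- nu) (1 - h) ^+ 2 * \sum_(q <- nu) i.1 * q.1 * K i.2 q.2.
  by apply: eq_bigr => i _; rewrite mulr_sumr; apply: eq_bigr => j _; ring.
by rewrite -!mulr_sumr; ring.
Qed.

Let form_ge0 t m A nu : probs A nu -> 0 <= form (kern t m) nu.
Proof.
move=> [nuA _]; rewrite /form big_seq sumr_ge0// => p /nuA[p0 _].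
rewrite big_seq sumr_ge0// => q /nuA[q0 _].
by do ?apply: mulr_ge0.
Qed.

Let probs_mix A nu x (h : R) : probs A nu -> A x -> 0 <= h <= 1 ->
  probs A ((h, x) :: [seq ((1 - h) * p.1, p.2) | p <- nu]).
Proof.
move=> [nuA nu1] Ax /andP[h0 h1]; split.
  move=> p; rewrite inE => /orP[/eqP ->//|/mapP[q /nuA[q0 Aq] ->]].
  by split => //=; rewrite mulr_ge0// subr_ge0.
by rewrite big_cons big_map/= -mulr_sumr nu1; ring.
Qed.

(* First-order condition: moving a small mass [h] to the point [x] cannot
   decrease the energy by much. *)
Let almost_minimiser t m A (V : R) : A !=set0 ->
  V = inf [set form (kern t m) nu | nu in probs A] -> 0 < V ->
  exists nu, probs A nu /\ forall x, A x -> V / 2 <= pot (kern t m) nu x.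
Proof.
move=> [x0 Ax0]; set E := [set form (kern t m) nu | nu in probs A] => VE V0.
have E0 : lbound E 0 by move=> _ [nu Pnu <-]; exact: form_ge0 Pnu.
pose B : R := \sum_(k < m) wt (- t) k.
have dirac : probs A [:: (1, x0)].
  by split => [p|]; [rewrite inE => /eqP ->|rewrite big_seq1].
have Einf : has_inf E.
  by split; [exists (form (kern t m) [:: (1, x0)]); exists [:: (1, x0)]|exists 0].
have VB : V <= B.
  rewrite VE; apply: (inf_lbound Einf.2); exists [:: (1, x0)] => //.
  by rewrite /form !big_seq1 kernxx !mul1r.
have B0 : 0 < B by lra.
(* [B] is the energy of a Dirac mass. With this [h], the self-energy of the moved mass is
   [h * V / 4]; like the defect [h * V / 2] allowed to [nu], it is smaller than the first-order gain
   [2 * h * V]. *)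
pose h := V / (4 * B).
have h0 : 0 < h by rewrite divr_gt0// mulr_gt0.
have hB : h * B = V / 4 by rewrite /h; field; lra.
have h1 : h <= 1 / 4.
  by rewrite /h ler_pdivrMr ?mulr_gt0//; lra.
have hV : 0 < h * V / 2 by rewrite divr_gt0// mulr_gt0.
clearbody h.
have [_ [nu Pnu <-] nuV] := inf_adherent hV Einf; rewrite -VE in nuV.
exists nu; split => // x Ax.
have Pmix : probs A ((h, x) :: [seq ((1 - h) * p.1, p.2) | p <- nu]).
  by apply: probs_mix => //; lra.
have : V <= form (kern t m) ((h, x) :: [seq ((1 - h) * p.1, p.2) | p <- nu]).
  by rewrite VE; apply: (inf_lbound Einf.2); exists ((h, x) :: [seq ((1 - h) * p.1, p.2) | p <- nu]).
rewrite form_mix; last exact: kernC.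
rewrite kernxx -/B.
have U0 : 0 <= pot (kern t m) nu x.
  rewrite /pot big_seq sumr_ge0// => p /(Pnu.1)[p0 _]; exact: mulr_ge0.
move: (pot _ _ _) U0 (form _ _) nuV => U U0 I nuV VI.
have I1 : (1 - h) ^+ 2 * I <= (1 - h) ^+ 2 * (V + h * V / 2).
  by rewrite ler_wpM2l ?sqr_ge0// ltW.
have hh : h ^+ 2 * B = h * V / 4 by rewrite expr2 -mulrA hB mulrA.
have h0' := ltW h0; have V0' := ltW V0.
have U2 : 0 <= h * h * U. by do ?apply: mulr_ge0.
have V1 : 0 <= h * V by rewrite mulr_ge0.
have V2 : h * h * V <= h * V / 4.
  by rewrite -mulrA; have := ler_wpM2r V1 h1; move: (h * V) => hv; lra.
have V3 : h * h * h * V <= h * V / 4.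
  apply: le_trans V2; rewrite -[leRHS]mul1r -!mulrA ler_wpM2r//; last lra.
  by do ?apply: mulr_ge0.
have EI : (1 - h) ^+ 2 * (V + h * V / 2) =
    V - 2 * (h * V) + h * V / 2 + h * h * h * V / 2 by field.
have EU : 2 * h * (1 - h) * U = 2 * (h * U) - 2 * (h * h * U) by ring.
have key : h * (V / 2) <= h * U.
  rewrite mulrA; move: VI; rewrite hh EU => VI.
  move: I1; rewrite EI => I1.
  move: (h * V) (h * U) (h * h * U) (h * h * h * V) ((1 - h) ^+ 2 * I)
    V1 U2 V3 VI I1 => x1 x2 x3 x4 x5; lra.
by rewrite ler_pM2l in key.
Qed.

(** A potential of at least [V / 2] at [x] forces, at some scale [k], a ball about [x] of mass at
    least a multiple of [V * wt t k]. A Vitali subfamily of such balls is disjoint, so the total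
    mass [1] bounds the cost of its enlargement, a cover of [A]. *)
Let pot_cover (t u : R) m A nu (V a : R) : 0 < u -> u < t -> 0 < V -> 0 < a ->
  probs A nu -> (forall x, A x -> V / 2 <= pot (kern u m) nu x) ->
  (a%:E <= content (wt t) 0 A)%E ->
  a * (V * (1 - wt (t - u) 1)) <= 2.
Proof.
move=> u0 ut V0 a0 [nuA nu1] nuV aA.
have tu0 : 0 < t - u by lra.
(* Normalised so that the series of [c * V * wt (t - u) k] has sum [V / 2]; its partial sums are
   strictly smaller. *)
pose c := (1 - wt (t - u) 1) / 2.
have c0 : 0 < c by rewrite divr_gt0// subr_gt0 wt_lt1.
have cV0 : 0 < c * V := mulr_gt0 c0 V0.
pose mass k x := \sum_(p <- nu) p.1 * close k x p.2.
have mass0 k x : 0 <= mass k x.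
  by rewrite /mass big_seq sumr_ge0// => p /nuA[p0 _]; exact: mulr_ge0.
have potE x : pot (kern u m) nu x = \sum_(k < m) wt (- u) k * mass k x.
  rewrite /pot /kern; under eq_bigr do rewrite mulr_sumr.
  rewrite exchange_big; apply: eq_bigr => k _; rewrite mulr_sumr.
  by apply: eq_bigr => p _; ring.
have big x : A x -> exists k, c * V * wt t k <= mass k x.
  move=> Ax; apply: contrapT => nk.
  have small k : mass k x <= c * V * wt t k.
    by rewrite leNgt; apply/negP => /ltW ck; apply: nk; exists k.
  have := nuV _ Ax; rewrite leNgt => /negP; apply.
  rewrite potE.
  apply: (@le_lt_trans _ _ (\sum_(k < m) c * V * wt (t - u) k)).
    apply: ler_sum => k _; have := ler_wpM2l (ltW (wt_gt0 (- u) k)) (small k).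
    by rewrite (wtD t (- u)); lra.
  rewrite -mulr_sumr.
  have -> : \sum_(k < m) wt (t - u) k = (1 - wt (t - u) m) / (1 - wt (t - u) 1).
    have w1 := wt_lt1 tu0.
    apply/eqP; rewrite eq_sym -subr_eq0; apply/eqP.
    elim: m {potE nuV} => [|m IH]; first by rewrite big_ord0 wt0; field; lra.
    rewrite big_ord_recr/= (wtS _ m) opprD addrA -[RHS]IH; field; lra.
  rewrite /c; have w1 := wt_lt1 tu0; have wm := wt_gt0 (t - u) m.
  have -> : (1 - wt (t - u) 1) / 2 * V * ((1 - wt (t - u) m) / (1 - wt (t - u) 1)) =
    V / 2 * (1 - wt (t - u) m) by field; lra.
  by have := mulr_gt0 V0 wm; lra.
pose near (i j : T * nat) := mdist i.1 j.1 < rad i.2.+2 + rad j.2.+2.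
pose G := [set i : T * nat | c * V * wt t i.2 <= mass i.2 i.1].
have [| |S [SG Sdis Scov]] := @vitali _ near snd G.
- by move=> i _; rewrite /near mdistxx addr_gt0// rad_gt0.
- by move=> i j; rewrite /near metric_sym addrC.
pose F (i : T * nat) := ([set z | mdist i.1 z < 2 * rad i.2.+2], i.2).
have cov : cover 0 A (F @` S).
  split=> [_ [i _ <-]|x Ax].
    split=> // y z /= iy iz; have := metric_triangle y i.1 z.
    by rewrite (metric_sym y i.1); move: iy iz; rewrite !radS; lra.
  have [k xk] := big _ Ax; have [i Si [xi ik]] := Scov (x, k) xk.
  exists (F i); first by exists i.
  rewrite /= metric_sym; apply: lt_le_trans xi _ => /=.
  by have := @rad_le R i.2.+2 k.+2 ik; lra.
have : (a%:E <= ((c * V)^-1)%:E)%E.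
  apply: le_trans aA (le_trans (content_le _ cov) _).
  apply: le_trans (esum_image_le _ _ _) _.
    by move=> p; rewrite lee_fin ltW// wt_gt0.
  apply: ge_ereal_sup => _ [X [finX XS] <-].
  have [s Xs] := (finite_seqP _).1 finX.
  have Xs' : X = [set` undup s].
    by rewrite Xs; apply/seteqP; split => p /=; rewrite mem_undup.
  rewrite Xs' -fsbig_seq ?undup_uniq// sumEFin lee_fin -div1r ler_pdivlMr//.
  rewrite mulr_suml.
  apply: (@le_trans _ _ (\sum_(i <- undup s) mass i.2 i.1)).
    rewrite big_seq [leRHS]big_seq; apply: ler_sum => i si /=.
    by rewrite mulrC; apply: SG; apply: XS; rewrite Xs'.
  rewrite /mass exchange_big/= -nu1 big_seq [leRHS]big_seq.
  apply: ler_sum => p /nuA[p0 _]; rewrite -mulr_sumr -[leRHS]mulr1 ler_wpM2l//.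
  apply: (@sum_indic_le1 _ _ _ (fun i => mdist i.1 p.2 < rad i.2.+2)).
    exact: undup_uniq.
  move=> i j si sj ip jp; apply: Sdis; [by apply: XS; rewrite Xs'..|].
  rewrite /near; have := metric_triangle i.1 p.2 j.1.
  by rewrite (metric_sym p.2 j.1); lra.
rewrite lee_fin -div1r ler_pdivlMr// /c; lra.
Qed.

(** If the infimum of the energies exceeded a fixed multiple of [1 / a], an almost minimiser would
    contradict [pot_cover]. Each term of the kernel is below the whole. The constant depends on
    neither [A] nor [m], so the bound survives a limit. *)
Lemma energy_bound (t u a : R) : 0 < u -> u < t -> 0 < a ->
  exists2 C, 0 < C & forall A m, (a%:E <= content (wt t) 0 A)%E ->
    exists2 nu, probs A nu &
      forall k, (k < m)%N -> pair_mass nu k <= C * wt u k.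
Proof.
move=> u0 ut a0; have tu0 : 0 < t - u by lra.
have c0 : 0 < 1 - wt (t - u) 1 by rewrite subr_gt0 wt_lt1.
pose C := 2 / (a * (1 - wt (t - u) 1)).
have C0 : 0 < C by rewrite divr_gt0// mulr_gt0.
exists (C + C) => [|A m' aA]; first by lra.
pose m := m'.+1.
have A0 : A !=set0.
  apply: contrapT => nA; move: aA; apply/negP; rewrite -ltNge.
  rewrite (@le_lt_trans _ _ 0%E)//.
  apply: le_trans (content_le (U := set0) _ _) _; last by rewrite /cost esum_set0.
  by split => [p []|x Ax]; case: nA; exists x.
have [x0 Ax0] := A0.
set E := [set form (kern u m) nu | nu in probs A].
have E0 : lbound E 0 by move=> _ [nu Pnu <-]; exact: form_ge0 Pnu.
have Einf : has_inf E.
  split; last by exists 0.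
  exists (form (kern u m) [:: (1, x0)]); exists [:: (1, x0)] => //.
  by split => [p|]; [rewrite inE => /eqP ->|rewrite big_seq1].
have VC : inf E <= C.
  rewrite leNgt; apply/negP => CV.
  have V0 : 0 < inf E by lra.
  have [nu [Pnu nuV]] := @almost_minimiser u m A _ A0 erefl V0.
  have := pot_cover u0 ut V0 a0 Pnu nuV aA.
  have : a * (C * (1 - wt (t - u) 1)) = 2 by rewrite /C; field; lra.
  have : a * (C * (1 - wt (t - u) 1)) < a * (inf E * (1 - wt (t - u) 1)).
    by rewrite ltr_pM2l// ltr_pM2r.
  lra.
have [_ [nu Pnu <-] nuV] := inf_adherent C0 Einf.
exists nu => // k km.
have key : wt (- u) k * pair_mass nu k <= form (kern u m) nu.
  rewrite /pair_mass mulr_sumr /form big_seq [leRHS]big_seq.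
  apply: ler_sum => p /(Pnu.1)[p0 _]; rewrite mulr_sumr big_seq [leRHS]big_seq.
  apply: ler_sum => q /(Pnu.1)[q0 _]; rewrite mulrCA ler_wpM2l ?mulr_ge0//.
  have km' : (k < m)%N by rewrite /m ltnS ltnW.
  rewrite /kern (bigD1 (Ordinal km'))//= lerDl sumr_ge0// => i _.
  by rewrite mulr_ge0// ltW// wt_gt0.
have := ler_wpM2r (ltW (wt_gt0 u k)) (le_trans key (ltW nuV)).
rewrite mulrAC wtN mul1r => /le_trans; apply.
by apply: ler_wpM2r; [exact/ltW/wt_gt0|rewrite lerD2r].
Qed.

End energy.

(** * Hausdorff measures *)

Section hausdorff.
Context {R : realType} {T : metricType R}.

Lemma diam_ge0 (E : set T) : (0 <= diam E)%E.
Proof. by apply: ereal_sup_ubound; left. Qed.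

Lemma le_diam (E : set T) x y : E x -> E y -> ((mdist x y)%:E <= diam E)%E.
Proof. by move=> Ex Ey; apply: ereal_sup_ubound; right; exists (x, y). Qed.

Lemma diam_small (E : set T) (r : R) : 0 <= r ->
  (forall x y, E x -> E y -> mdist x y <= r) -> (diam E <= r%:E)%E.
Proof.
move=> r0 Er; apply: ge_ereal_sup => _ [->|[[x y] [/= Ex Ey] <-]].
  by rewrite lee_fin.
by rewrite lee_fin; exact: Er.
Qed.

Lemma diam_pow_le (s : R) (E : set T) (r : R) : 0 < s -> 0 <= r ->
  (diam E <= r%:E)%E -> (diam_pow s E <= (r `^ s)%:E)%E.
Proof.
move=> s0 r0; rewrite /diam_pow; case: ifPn => _; first by rewrite lee_fin powR_ge0.
have := diam_ge0 E; case: (diam E) => [d| |]//; rewrite !lee_fin => d0 dr.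
by apply: ge0_ler_powR; rewrite ?nnegrE// ltW.
Qed.

Lemma diam_pow_ge0 (s : R) (E : set T) : (0 <= diam_pow s E)%E.
Proof. by rewrite /diam_pow; case: ifPn => // _; exact: poweR_ge0. Qed.

(** In a cover of small total cost every set costs little, hence has small diameter: vanishing
    content, without restriction on scales, makes the measure vanish. Such a cover is countable,
    having finitely many sets at each scale. *)
Lemma content_gt0 (s : R) (A : set T) : 0 < s ->
  (0 < hausdorff_measure s A)%E -> (0 < content (wt s) 0 A)%E.
Proof.
move=> s0; rewrite !ltNge; apply: contra => cA.
apply: ge_ereal_sup => _ [delta /= delta0 <-].
apply/lee_addgt0Pr => e e0; rewrite add0e.
have [k0 k0d] := rad_small delta0.
pose h := Num.min e (wt s k0).
have h0 : 0 < h by rewrite lt_min e0 wt_gt0.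
have [|U Ucov Uh] := @content_cover _ _ (wt s) 0 A h.
  by apply: le_lt_trans cA _; rewrite lte_fin.
have Uk p : U p -> (diam p.1 <= delta%:E)%E.
  move=> Up; have [ps _] := Ucov.1 _ Up.
  apply: (@le_trans _ _ (rad p.2)%:E).
    by apply: diam_small; [exact/ltW/rad_gt0|exact: ps].
  rewrite lee_fin ltW// (le_lt_trans _ k0d)//; apply: rad_le.
  rewrite leqNgt; apply/negP => /ltnW pk0.
  have : ((wt s p.2)%:E < (wt s k0)%:E)%E.
    apply: (@le_lt_trans _ _ (cost (wt s) U)).
      rewrite /cost -(@esum_set1 _ _ p (fun p => (wt s p.2)%:E)).
        apply: esum_subset => [_ ->//|q _].
        by rewrite lee_fin ltW// wt_gt0.
      by rewrite lee_fin ltW// wt_gt0.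
    by apply: lt_le_trans Uh _; rewrite lee_fin /h ge_min lexx orbT.
  rewrite lte_fin -!wt_rad ltNge => /negP; apply.
  have radn k : (rad k : R) \is Num.nneg by rewrite nnegrE ltW// rad_gt0.
  by apply: ge0_ler_powR; [exact: ltW| | |exact: rad_le].
have Ucnt : countable U.
  have -> : U = \bigcup_K (U `&` [set p | (p.2 < K)%N]).
    apply/seteqP; split=> [p Up|p [K _ []]//].
    by exists p.2.+1 => //; split => /=.
  apply: bigcup_countable => // K _; apply: finite_set_countable.
  have [N NP] := @large_entries R T (wt s) K (wt_gt0 s) h.
  have [sq [_ -> _]] := NP U (ltW Uh); by apply/finite_seqP; exists sq.
have /countable_injP [f finj] := Ucnt.
(* Numbers outside the image of [f] get the empty set, which costs [0] by the convention in
   [diam_pow]. *)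
pose F n : set T := [set x | exists p, [/\ U p, f p = n & p.1 x]].
have FU p : U p -> F (f p) = p.1.
  move=> Up; apply/seteqP; split => [x [q [Uq qp qx]]|x px]; last by exists p.
  by rewrite -(finj q p) ?inE.
have F0 n : ~ (f @` U) n -> F n = set0.
  by move=> nU; apply/seteqP; split => // x [p [Up fp _]]; apply: nU; exists p.
have Fcov : delta_cover delta A F.
  split=> [x /Ucov.2 [p Up px]|n]; first by exists (f p) => //; rewrite FU.
  have [[p Up <-]|nU] := pselect ((f @` U) n); first by rewrite FU// Uk.
  by rewrite F0// diam_small// ltW.
apply: (@le_trans _ _ (cost (wt s) U)); last first.
  by apply/ltW/(lt_le_trans Uh); rewrite lee_fin /h ge_min lexx.
apply: le_trans (_ : \sum_(i <oo) diam_pow s (F i) <= _)%E.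
  by apply: ereal_inf_lbound; exists F.
rewrite nneseries_esumT; last by move=> n; exact: diam_pow_ge0.
rewrite (esumID (f @` U)); last by move=> n _; exact: diam_pow_ge0.
rewrite !setTI [X in (_ + X)%E]esum1 ?adde0; last first.
  by move=> n nU; rewrite F0// /diam_pow asboolT.
rewrite esum_image//; apply: le_esum => p Up; rewrite FU// -wt_rad.
apply: diam_pow_le => //; first exact/ltW/rad_gt0.
by apply: diam_small; [exact/ltW/rad_gt0|have [ps _] := Ucov.1 _ Up].
Qed.

End hausdorff.

(** * Mass distribution principle *)

Lemma wt_small {R : realType} (s e : R) : 0 < s -> 0 < e -> exists n, wt s n < e.
Proof.
move=> s0 e0; have [k ke] := @rad_small R (e `^ s^-1) (powR_gt0 _ e0).
exists k; rewrite -wt_rad.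
have -> : e = (e `^ s^-1) `^ s.
  by rewrite -powRrM mulVf ?gt_eqF// powRr1// ltW.
by rewrite gt0_ltr_powR// nnegrE ?powR_ge0// ltW// rad_gt0.
Qed.

Lemma wt_powR {R : realType} (s t : R) n : wt s n `^ t = wt (s * t) n.
Proof. by rewrite /wt -powRrM; congr powR; ring. Qed.

(** For positive [x], [n] is the last scale with [x < wt al n], so that [wt al n.+1 <= x]. The term
    [e] serves for [x = 0], where there is no last scale. *)
Lemma wt_scale {R : realType} (al t x e : R) : 0 < al -> 0 < t -> 0 < e ->
  0 <= x <= wt al 1 ->
  exists n, x < wt al n /\ wt (al * t) n <= wt (- (al * t)) 1 * x `^ t + e.
Proof.
move=> al0 t0 e0 /andP[x0 x1].
have w1 : wt al 1 < 1 by exact: wt_lt1.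
have at0 : 0 < al * t by exact: mulr_gt0.
move: x0; rewrite le_eqVlt => /orP[/eqP <-|x0].
  have [n ne] := wt_small at0 e0; exists n; rewrite wt_gt0; split => //.
  by rewrite (le_trans (ltW ne))// lerDr mulr_ge0 ?powR_ge0// ltW// wt_gt0.
have exn : exists n, wt al n <= x by have [n /ltW] := wt_small al0 x0; exists n.
case: (ex_minnP exn) => -[|m] mx mmin.
  by move: mx; rewrite wt0; lra.
exists m; split.
  by rewrite ltNge; apply/negP => /mmin; rewrite ltnn.
rewrite (@le_trans _ _ (wt (- (al * t)) 1 * x `^ t))//; last by rewrite lerDl ltW.
have -> : wt (al * t) m = wt (- (al * t)) 1 * wt (al * t) m.+1.
  by rewrite (wtS _ m) mulrCA (wtN (al * t) 1) mulr1.
rewrite ler_pM2l ?wt_gt0// -wt_powR.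
by rewrite ge0_ler_powR ?nnegrE// ?ltW// wt_gt0.
Qed.

Section mass_distribution.
Context {R : realType} {d} {Om : measurableType d} (nu : probability Om R).
Context {Y : metricType R}.
Variables (psi : Om -> Y) (al t : R).
Hypotheses (al_gt0 : 0 < al) (t_gt0 : 0 < t).
Local Open Scope ereal_scope.

Let near_diag n := [set uv : Om * Om | (mdist (psi uv.1) (psi uv.2) < wt al n)%R].

Hypothesis mnear : forall n, measurable (near_diag n).

(** The measure of the points that [psi] sends to the ball of radius [wt al n] about [psi u]; [pot]
    is a dyadic [t]-potential of the image of [nu]. *)
Let mass n (u : Om) : \bar R := nu (xsection (near_diag n) u).

Let pot (u : Om) : \bar R := \sum_(n <oo) (wt (- (al * t)) n)%:E * mass n u.

Let mmass n : measurable_fun setT (mass n).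
Proof. exact: measurable_fun_xsection. Qed.

Let mterm n : measurable_fun setT (fun u => (wt (- (al * t)) n)%:E * mass n u).
Proof. exact: emeasurable_funM. Qed.

Let term_ge0 n u : 0 <= (wt (- (al * t)) n)%:E * mass n u.
Proof. by rewrite mule_ge0// lee_fin ltW// wt_gt0. Qed.

Let pot_ge0 u : 0 <= pot u.
Proof. by apply: nneseries_ge0 => n _ _; exact: term_ge0. Qed.

Let mpot : measurable_fun setT pot.
Proof. by apply: ge0_emeasurable_sum => // n u _ _; exact: term_ge0. Qed.

(** Finite energy makes the potential finite almost everywhere, so bounded by some [M] on a set [TM]
    of positive measure [p]. A ball about the image of a point of [TM] then has mass at most
    [M * wt (al * t) n], and a cover of the range of too small a cost could not carry the mass
    [p]. *)
Lemma mass_distribution :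
  \sum_(n <oo) (wt (- (al * t)) n)%:E * (nu \x nu) (near_diag n) < +oo ->
  0 < hausdorff_measure t (range psi).
Proof.
move=> fin.
have int_pot : \int[nu]_u pot u < +oo.
  rewrite /pot integral_nneseries//.
  rewrite (eq_eseriesr (g := fun n => (wt (- (al * t)) n)%:E * (nu \x nu) (near_diag n)))//.
  move=> n _; rewrite ge0_integralZl//; first by rewrite lee_fin ltW// wt_gt0.
have pot_fin : nu.-negligible [set u | pot u = +oo].
  have /integrable_ae : nu.-integrable setT pot.
    apply/integrableP; split => //.
    by under eq_integral do rewrite gee0_abs//.
  move=> /(_ measurableT) [N [mN N0 NP]]; exists N; split => // u /= pu.
  by apply: NP => /= /(_ I); rewrite pu.
pose low M := [set u | pot u <= M%:R%:E].
have mlow M : measurable (low M).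
  by rewrite -[low M]setTI; exact: emeasurable_fun_infty_c.
have [M M0] : exists M, nu (low M) != 0.
  apply: contrapT => nM.
  have : nu setT = 0.
    apply/negligibleP => //.
    apply: (@negligibleS _ _ _ nu ([set u | pot u = +oo] `|` \bigcup_M low M)).
      move=> u _; have := pot_ge0 u; rewrite /setU/=.
      case E : (pot u) => [r| |]// r0; [right|by left].
      exists (Num.bound r) => //; rewrite /low/= E lee_fin.
      by apply/ltW/archi_boundP; rewrite -lee_fin.
    apply: negligibleU => //; apply: negligible_bigcup => M.
    apply/negligibleP => //; apply: contrapT => Mn0; apply: nM.
    by exists M; apply/eqP.
  by rewrite probability_setT => /eqP; rewrite onee_eq0.
set TM := low M in M0.
have mass_le u n : TM u -> mass n u <= (M%:R * wt (al * t) n)%:E.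
  move=> uM; have : (wt (- (al * t)) n)%:E * mass n u <= M%:R%:E.
    apply: le_trans uM; rewrite /pot (@nneseriesD1 _ _ n)//.
    by rewrite leeDl// nneseries_ge0// => k _ _; exact: term_ge0.
  have : mass n u \is a fin_num by rewrite fin_num_measure//; exact: measurable_xsection.
  move=> /fineK <-; rewrite -EFinM !lee_fin => wM.
  have := ler_wpM2r (ltW (wt_gt0 (al * t) n)) wM.
  by rewrite mulrAC (wtN (al * t) n) mul1r.
rewrite ltNge; apply/negP => H0.
have [p p0 pE] : exists2 p : R, (0 < p)%R & nu TM = p%:E.
  have fM : nu TM \is a fin_num by apply: fin_num_measure; exact: mlow.
  exists (fine (nu TM)); last by rewrite fineK.
  by rewrite -lte_fin fineK// lt0e M0 measure_ge0.
pose D := wt (- (al * t)) 1.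
have D0 : (0 < D)%R by exact: wt_gt0.
(* Chosen so that [(M + 1) * (D + 1) * e = p / 2]; [D] is the factor lost in [wt_scale]. *)
pose e := (p / ((M%:R + 1) * (D + 1)) / 2)%R.
have M1 : (0 < M%:R + 1 :> R)%R by rewrite ltr_wpDl.
have e0 : (0 < e)%R.
  have MD : (0 < (M%:R + 1) * (D + 1))%R by apply: mulr_gt0 => //; lra.
  by rewrite /e divr_gt0// divr_gt0.
have : hausdorff_content t (wt al 1) (range psi) < e%:E.
  apply: (@le_lt_trans _ _ 0); last by rewrite lte_fin.
  apply: le_trans H0; apply: ereal_sup_ubound; exists (wt al 1) => //=.
  exact: wt_gt0.
move=> /ereal_inf_lt [_ [F [Fcov Fdiam] <-] Fe].
pose ei (i : nat) := (e * rad i.+1)%R.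
have ei0 i : (0 < ei i)%R by rewrite mulr_gt0// rad_gt0.
(* The preimage of an arbitrary [F i] may fail to be measurable; its part in [TM] is enclosed in the
   preimage of a ball about the image of one of its points. *)
have /choice [V VP] : forall i, exists V : set Om, [/\ measurable V,
    nu V <= (M%:R * D)%:E * diam_pow t (F i) + (M%:R * ei i)%:E &
    forall u, TM u -> F i (psi u) -> V u].
  move=> i; have [[u0 [Tu0 Fu0]]|nu0] := pselect (exists u, TM u /\ F i (psi u)); last first.
    exists set0; split => //.
      rewrite measure0; apply: adde_ge0; last by rewrite lee_fin; apply: mulr_ge0 => //; exact/ltW/ei0.
      by apply: mule_ge0; [rewrite lee_fin; apply: mulr_ge0 => //; exact: ltW|exact: diam_pow_ge0].
    by move=> u Tu Fu; apply: nu0; exists u.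
  have [x xE] : exists x, diam (F i) = x%:E.
    have := diam_ge0 (F i); have := Fdiam i.
    by case: (diam (F i)) => [x| |]// _ _; exists x.
  have [|n [xn nx]] := @wt_scale R al t x (ei i) al_gt0 t_gt0 (ei0 i).
    by have := Fdiam i; have := diam_ge0 (F i); rewrite xE !lee_fin => -> ->.
  exists (xsection (near_diag n) u0); split.
  - exact: measurable_xsection.
  - apply: le_trans (mass_le _ _ Tu0) _.
    rewrite /diam_pow asboolF; last first.
      by move=> Fi0; rewrite Fi0 in Fu0.
    rewrite xE /= -EFinM -EFinD lee_fin -mulrA -mulrDr.
    by rewrite ler_wpM2l.
  - move=> u Tu Fu; apply/xsectionP => /=; apply: le_lt_trans xn.
    by rewrite -lee_fin -xE; exact: le_diam.
have : nu TM <= (M%:R * D * e + M%:R * e)%:E.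
  apply: (@le_trans _ _ (\sum_(i <oo) nu (V i))).
    apply: measure_sigma_subadditive; [by move=> i; have [] := VP i|exact: mlow|].
    move=> u Tu; have [i _ Fi] := Fcov (psi u) (imageP _ I).
    by exists i => //; have [_ _] := VP i; exact.
  apply: (@le_trans _ _ (\sum_(i <oo) ((M%:R * D)%:E * diam_pow t (F i) + (M%:R * ei i)%:E))).
    by apply: lee_nneseries => // i _; have [] := VP i.
  have dp0 i : 0 <= (M%:R * D)%:E * diam_pow t (F i).
    by apply: mule_ge0; [rewrite lee_fin; apply: mulr_ge0 => //; exact: ltW|exact: diam_pow_ge0].
  have Me0 i : 0 <= (M%:R * ei i)%:E by rewrite lee_fin; apply: mulr_ge0 => //; exact/ltW/ei0.
  rewrite nneseriesD// EFinD; apply: leeD.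
    rewrite nneseriesZl; last by move=> i _; exact: diam_pow_ge0.
    by rewrite [leRHS]EFinM; apply: lee_wpmul2l; [rewrite lee_fin; apply: mulr_ge0 => //; exact: ltW|exact: ltW].
  apply: lime_le; first exact: is_cvg_nneseries.
  near=> n; rewrite sumEFin lee_fin big_mkord -mulr_sumr; apply: ler_wpM2l => //.
  rewrite -mulr_sumr sum_rad mulrBr mulr1 gerBl.
  by apply: mulr_ge0; [exact: ltW|exact/ltW/rad_gt0].
rewrite pE lee_fin; apply/negP; rewrite -ltNge.
have -> : (M%:R * D * e + M%:R * e = M%:R * ((D + 1) * e))%R by ring.
have De : (0 < (D + 1) * e)%R by rewrite mulr_gt0//; lra.
apply: (@le_lt_trans _ _ ((M%:R + 1) * ((D + 1) * e))%R).
  by rewrite ler_wpM2r ?ltW//; lra.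
have D10 : (0 < D + 1)%R by lra.
have -> : ((M%:R + 1) * ((D + 1) * e) = p / 2)%R.
  by rewrite /e; field; rewrite !gt_eqF.
lra.
Unshelve. all: by end_near.
Qed.

End mass_distribution.

(** * Transversality *)

Lemma wt_addn {R : realType} (s : R) j k : wt s (j + k) = wt s j * wt s k.
Proof. by rewrite (wtE s (j + k)) (wtE s j) (wtE s k) exprD. Qed.

Lemma open_mball {R : realType} {Y : metricType R} (y : Y) (r : R) :
  open [set z | mdist y z < r].
Proof.
rewrite openE => z /= yz; apply/nbhs_ballP; exists (r - mdist y z) => /=.
  by rewrite subr_gt0.
move=> w; rewrite ballEmdist/= => zw.
by have := metric_triangle y z w; lra.
Qed.

Lemma open_borel {T : topologicalType} (A : set T) : open A -> borel A.
Proof. by move=> oA; apply: sub_gen_smallest. Qed.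

(** The inequality holds exactly when, for some [k], a point of a countable dense set is within
    [rad k] of [f x] and within [r - rad k] of [g x]. *)
Lemma measurable_close {R : realType} {Y : metricType R} {d} {T : measurableType d}
    (f g : T -> Y) (r : R) : separable_space Y ->
  (forall B, borel B -> measurable (f @^-1` B)) ->
  (forall B, borel B -> measurable (g @^-1` B)) ->
  measurable [set x | mdist (f x) (g x) < r].
Proof.
move=> [D Dcnt Ddense] mf mg.
have mball h y e : (forall B, borel B -> measurable (h @^-1` B)) ->
    measurable [set x : T | mdist y (h x : Y) < e].
  move=> mh; exact: (mh [set z | mdist y z < e] (open_borel (open_mball _ _))).
have -> : [set x | mdist (f x) (g x) < r] = \bigcup_k \bigcup_(y in D)
    ([set x | mdist y (f x) < rad k] `&` [set x | mdist y (g x) < r - rad k]).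
  apply/seteqP; split => [x /= fg|x [k _ [y Dy [/= fy gy]]]]; last first.
    by have := metric_triangle (f x) y (g x); rewrite (metric_sym (f x) y)/=; lra.
  have [k kr] := @rad_small R ((r - mdist (f x) (g x)) / 2) ltac:(lra).
  have [|y [/= fy Dy]] := Ddense _ _ (open_mball (f x) (rad k)).
    by exists (f x); rewrite /= mdistxx rad_gt0.
  exists k => //; exists y => //; split => /=; first by rewrite metric_sym.
  by have := metric_triangle y (f x) (g x); rewrite (metric_sym y (f x)); lra.
apply: bigcupT_measurable => k; rewrite bigcup_set_type.
apply: countable_bigcupT_measurable.
  by rewrite (eq_countable (card_setT D)).
by move=> y; apply: measurableI; exact: mball.
Qed.

Section ae_dimension.
Context {R : realType} {d1 d2} {L : measurableType d1} {Om : measurableType d2}.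
Context (P : probability L R) (nu : probability Om R) {Y : metricType R}.
Variables (F : L * Om -> Y) (rho : Om * Om -> R) (s t al ka C C1 : R).
Hypotheses (al_gt0 : 0 < al) (ka_gt0 : 0 < ka) (C_gt0 : 0 < C) (t_gt0 : 0 < t)
  (ts : al * t < s) (ska : s < al * ka) (C1_gt0 : 0 < C1).
Hypothesis Ysep : separable_space Y.
Hypothesis mF : forall B, borel B -> measurable (F @^-1` B).
Hypothesis mrho : forall r, measurable [set uv | rho uv < r].
Hypothesis rho_bound : forall k,
  ((nu \x nu) [set uv | (rho uv < rad k.+2)%R] <= (C1 * wt s k)%:E)%E.
Hypothesis transv : forall delta, 0 < delta -> forall uv, 0 < rho uv ->
  (P [set l | (mdist (F (l, uv.1)) (F (l, uv.2)) <= delta * rho uv `^ al)%R]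
    <= (C * delta `^ ka)%:E)%E.

Let nn : probability (Om * Om)%type R := (nu \x nu)%E.

Let A n := [set z : L * (Om * Om) |
  mdist (F (z.1, z.2.1)) (F (z.1, z.2.2)) < wt al n].

Let mA n : measurable (A n).
Proof.
apply: measurable_close => // B bB.
  rewrite (_ : _ @^-1` B = (fun z : L * (Om * Om) => (z.1, z.2.1)) @^-1` (F @^-1` B))//.
  rewrite -[X in measurable X]setTI; apply: (_ : measurable_fun setT _) => //; last exact: mF.
  by apply: measurable_fun_pair => //; exact: measurableT_comp.
rewrite (_ : _ @^-1` B = (fun z : L * (Om * Om) => (z.1, z.2.2)) @^-1` (F @^-1` B))//.
rewrite -[X in measurable X]setTI; apply: (_ : measurable_fun setT _) => //; last exact: mF.
by apply: measurable_fun_pair => //; exact: measurableT_comp.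
Qed.

Let E k := [set uv : Om * Om | rho uv < rad k.+2].

(** Transversality with [delta = wt al n / rho uv ^ al], which turns its threshold into
    [wt al n]. *)
Let far n j uv : rad j <= rho uv ->
  (P (ysection (A n) uv) <= (C * wt (al * ka) n * wt (- (al * ka)) j)%:E)%E.
Proof.
move=> jr; have r0 : 0 < rho uv by apply: lt_le_trans jr; exact: rad_gt0.
have ra0 : 0 < rho uv `^ al by exact: powR_gt0.
have d0 : 0 < wt al n / rho uv `^ al by rewrite divr_gt0// wt_gt0.
apply: (@le_trans _ _ (C * (wt al n / rho uv `^ al) `^ ka)%:E).
  apply: le_trans (transv d0 r0); rewrite divfK ?gt_eqF//.
  have mc r : measurable [set l | mdist (F (l, uv.1)) (F (l, uv.2)) < r].
    apply: measurable_close => // B bB.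
      rewrite (_ : _ @^-1` B = ysection (F @^-1` B) uv.1); first by apply: measurable_ysection; exact: mF.
      by apply/seteqP; split => l; rewrite /ysection /= inE.
    rewrite (_ : _ @^-1` B = ysection (F @^-1` B) uv.2); first by apply: measurable_ysection; exact: mF.
    by apply/seteqP; split => l; rewrite /ysection /= inE.
  apply: le_measure; rewrite ?inE.
  - exact: measurable_ysection.
  - rewrite (_ : [set l | _] = \bigcap_k [set l | mdist (F (l, uv.1)) (F (l, uv.2)) < wt al n + rad k]).
      by apply: bigcapT_measurable => k; exact: mc.
    apply/seteqP; split => [l /= ll k _ /=|l ll /=].
      by apply: le_lt_trans ll _; rewrite ltrDl rad_gt0.
    apply/ler_addgt0Pr => e e0; have [k ke] := rad_small e0.
    by have /= := ll k I; lra.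
  - by move=> l; rewrite /ysection /= inE => /ltW.
have w0 : 0 <= wt al n by exact/ltW/wt_gt0.
have i0 : 0 <= (rho uv `^ al)^-1 by rewrite invr_ge0 ltW.
rewrite lee_fin -mulrA ler_pM2l// powRM//.
rewrite wt_powR ler_pM2l ?wt_gt0//.
rewrite -powR_inv1; last exact: ltW.
rewrite -!powRrM -wt_rad.
have -> : al * (-1 * ka) = - (al * ka) by ring.
rewrite !powRN lef_pV2 ?posrE ?powR_gt0 ?rad_gt0//.
have aka0 : 0 <= al * ka by exact/ltW/mulr_gt0.
by apply: ge0_ler_powR => //; rewrite nnegrE ltW// rad_gt0.
Qed.

Let a0 n := C * wt (al * ka) n * wt (- (al * ka)) 2.
Let b n k := C * wt (al * ka) n * wt (- (al * ka)) k.+3.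

(** The bound [far] made dyadic in [rho uv]: [a0 n] from [rad 2] on, [b n k] between [rad k.+3] and
    [rad k.+2], and the trivial bound [1] below [rad n.+2]. *)
Let h n uv : \bar R := ((a0 n)%:E + \sum_(k < n) (b n k)%:E * (\1_(E k) uv)%:E
   + (\1_(E n) uv)%:E)%E.

Let a0_ge0 n : 0 <= a0 n.
Proof. by rewrite /a0 ltW// !mulr_gt0// wt_gt0. Qed.

Let b_ge0 n k : 0 <= b n k.
Proof. by rewrite /b ltW// !mulr_gt0// wt_gt0. Qed.

Let sum_ge0 n uv : (0 <= \sum_(k < n) (b n k)%:E * (\1_(E k) uv)%:E)%E.
Proof. by apply: sume_ge0 => k _; rewrite -EFinM lee_fin mulr_ge0. Qed.

Let section_le n uv : (P (ysection (A n) uv) <= h n uv)%E.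
Proof.
have i0 k : (0 <= (\1_(E k) uv)%:E :> \bar R)%E by rewrite lee_fin.
have [r2|r2] := leP (rad 2) (rho uv).
  apply: le_trans (far n r2) _.
  by rewrite /h -/(a0 n) -addeA leeDl// adde_ge0.
have [rn|rn] := ltP (rho uv) (rad n.+2).
  apply: (@le_trans _ _ 1%E).
    by apply: probability_le1; exact: measurable_ysection.
  have En : \1_(E n) uv = 1 :> R by rewrite indicE mem_set.
  by rewrite /h En leeDr// adde_ge0// lee_fin a0_ge0.
have exk : exists k, rad k.+2 <= rho uv by exists n.
case: (ex_minnP exk) => -[|k] kr kmin; first by rewrite ltNge kr in r2.
have kn : (k < n)%N by exact: kmin.
have Ek : E k uv by rewrite /E/= ltNge; apply/negP => /kmin; rewrite ltnn.
apply: le_trans (far n kr) _.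
have Ek1 : \1_(E k) uv = 1 :> R by rewrite indicE mem_set.
rewrite -/(b n k) /h (bigD1 (Ordinal kn))//= Ek1 mule1.
set rest := (\sum_(i < n | _) _)%E.
have rest0 : (0 <= rest)%E.
  by apply: sume_ge0 => j _; rewrite -EFinM lee_fin mulr_ge0.
rewrite addeCA -addeA leeDl// adde_ge0//.
by rewrite adde_ge0// lee_fin a0_ge0.
Qed.

Let C2 := C * wt (- (al * ka)) 2 +
  C1 * C * wt (- (al * ka)) 3 * (1 - wt (al * ka - s) 1)^-1 + C1.

Let mE k : measurable (E k). Proof. exact: mrho. Qed.

Let mind k : measurable_fun setT (fun uv : Om * Om => (\1_(E k) uv)%:E : \bar R).
Proof. by apply/measurable_EFinP; exact: measurable_indic. Qed.

Let geometric e n : 0 < e ->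
  \sum_(k < n) wt e n * wt (- e) k <= (1 - wt e 1)^-1 :> R.
Proof.
move=> e0; have w1 := wt_lt1 e0; have w0 := wt_gt0 e 1.
have i0 : 0 < (1 - wt e 1)^-1 by rewrite invr_gt0 subr_gt0.
elim: n => [|n IH]; first by rewrite big_ord0 ltW.
have -> : \sum_(k < n.+1) wt e n.+1 * wt (- e) k =
    wt e 1 * (\sum_(k < n) wt e n * wt (- e) k + 1).
  rewrite big_ord_recr/= mulrDr mulr1 mulr_sumr; congr (_ + _).
    by apply: eq_bigr => k _; rewrite (wtS e n); ring.
  by rewrite (wtS e n) mulrAC (mulrC (wt e n)) (wtN e n) mul1r.
have : wt e 1 * (\sum_(k < n) wt e n * wt (- e) k + 1) <= wt e 1 * ((1 - wt e 1)^-1 + 1).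
  by rewrite ler_pM2l// lerD2r.
move/le_trans; apply.
have -> : wt e 1 * ((1 - wt e 1)^-1 + 1) = (1 - wt e 1)^-1 - (1 - wt e 1).
  by field; lra.
lra.
Qed.

(** [h] is integrated with [rho_bound]. As [s < al * ka], the terms of the middle sum grow
    geometrically in [k], so the sum is comparable to its last term, of order [wt s n]. *)
Let int_le n : (\int[nu \x nu]_uv P (ysection (A n) uv) <= (C2 * wt s n)%:E)%E.
Proof.
apply: (@le_trans _ _ (\int[nu \x nu]_uv h n uv)%E).
  apply: ge0_le_integral => //.
  - exact: measurable_fun_ysection.
  - apply: emeasurable_funD => //; apply: emeasurable_funD => //.
    by apply: emeasurable_sum => k; exact: emeasurable_funM.
have h1m : measurable_fun setT (fun uv => \sum_(k < n) (b n k)%:E * (\1_(E k) uv)%:E : \bar R)%E.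
  by apply: emeasurable_sum => k; exact: emeasurable_funM.
have bi0 (k : 'I_n) uv : (0 <= (b n k)%:E * (\1_(E k) uv)%:E)%E.
  by rewrite -EFinM lee_fin mulr_ge0.
rewrite /h ge0_integralD//; last 2 first.
- by move=> uv _; rewrite adde_ge0// lee_fin.
- exact: emeasurable_funD.
rewrite ge0_integralD//; last by move=> uv _; rewrite lee_fin.
rewrite integral_cst// integral_indic// setIT.
rewrite ge0_integral_sum//; last by move=> k; exact: emeasurable_funM.
have nn1 : ((nu \x nu) setT = 1)%E.
  by rewrite -setXTT product_measure1E// -[RHS]mule1 -{1}(probability_setT nu) -(probability_setT nu).
rewrite [X in (_ * X + _ + _)%E]nn1 mule1.
apply: (@le_trans _ _ ((a0 n)%:E + \sum_(k < n) (b n k * (C1 * wt s k))%:E + (C1 * wt s n)%:E)%E).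
  apply: leeD; last exact: rho_bound.
  apply: leeD => //; apply: lee_sum => k _.
  rewrite ge0_integralZl//; last by rewrite lee_fin.
  rewrite integral_indic// setIT [leRHS]EFinM; apply: lee_wpmul2l; first by rewrite lee_fin.
  exact: rho_bound.
rewrite sumEFin -!EFinD lee_fin /C2 !mulrDl; apply: lerD => //; apply: lerD.
  have e0 : 0 < al * ka - s by rewrite subr_gt0.
  have : wt (al * ka - s) n <= 1.
    by rewrite wtE exprn_ile1 ?ltW ?wt_gt0 ?wt_lt1.
  have -> : a0 n = C * wt (- (al * ka)) 2 * wt s n * wt (al * ka - s) n.
    rewrite -mulrA -(wtD s (al * ka - s) n) (addrC s) subrK.
    by rewrite /a0; ring.
  move=> w1; rewrite -[leRHS]mulr1; apply: ler_wpM2l => //.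
  by rewrite ltW// mulr_gt0 ?wt_gt0// mulr_gt0// wt_gt0.
have e0 : 0 < al * ka - s by rewrite subr_gt0.
have -> : \sum_(k < n) b n k * (C1 * wt s k) = C1 * C * wt (- (al * ka)) 3 * wt s n *
    \sum_(k < n) wt (al * ka - s) n * wt (- (al * ka - s)) k.
  rewrite mulr_sumr; apply: eq_bigr => k _; rewrite /b.
  have -> : wt (- (al * ka - s)) k = wt (- (al * ka)) k * wt s k.
    by rewrite opprB [s - _]addrC (wtD (- (al * ka)) s k).
  have -> : wt (- (al * ka)) k.+3 = wt (- (al * ka)) 3 * wt (- (al * ka)) k.
    by rewrite -[k.+3]/(3 + k)%N wt_addn.
  have -> : wt (al * ka) n = wt s n * wt (al * ka - s) n.
    by rewrite -(wtD s (al * ka - s) n) (addrC s) subrK.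
  by ring.
rewrite [leRHS]mulrAC; apply: ler_wpM2l; last exact: geometric.
by rewrite ltW// mulr_gt0 ?wt_gt0// mulr_gt0 ?wt_gt0// mulr_gt0.
Qed.

(** The energy to which [mass_distribution] is applied, for the map [F (l, _)]. *)
Let pot (l : L) : \bar R := (\sum_(n <oo) (wt (- (al * t)) n)%:E *
  (nu \x nu) (xsection (A n) l))%E.

Let term_ge0 n l : (0 <= (wt (- (al * t)) n)%:E * (nu \x nu) (xsection (A n) l))%E.
Proof. by rewrite mule_ge0// lee_fin ltW// wt_gt0. Qed.

Let msec n : measurable_fun setT (fun l => ((nu \x nu) (xsection (A n) l))%E : \bar R).
Proof. exact: (measurable_fun_xsection nn (mA n)). Qed.

Let mterm n : measurable_fun setT
  (fun l => (wt (- (al * t)) n)%:E * (nu \x nu) (xsection (A n) l))%E.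
Proof. exact: emeasurable_funM. Qed.

Lemma ae_positive_measure :
  {ae P, forall l, (0 < hausdorff_measure t (range (fun u => F (l, u))))%E}.
Proof.
have int_pot : (\int[P]_l pot l < +oo)%E.
  rewrite /pot integral_nneseries//.
  apply: (@le_lt_trans _ _ (\sum_(n <oo) (C2 * wt (s - al * t) n)%:E)%E).
    apply: lee_nneseries => [n _ _|n _].
      by apply: integral_ge0 => l _; exact: term_ge0.
    rewrite ge0_integralZl//; last by rewrite lee_fin ltW// wt_gt0.
    have -> : (\int[P]_l (nu \x nu) (xsection (A n) l) =
        \int[nu \x nu]_uv P (ysection (A n) uv))%E.
      have := @indic_fubini_tonelli _ _ _ _ R P nn (A n) (mA n).
      by rewrite indic_fubini_tonelli_FE// indic_fubini_tonelli_GE.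
    rewrite [leRHS](_ : _ = ((wt (- (al * t)) n)%:E * (C2 * wt s n)%:E)%E).
      by apply: lee_wpmul2l; [rewrite lee_fin ltW// wt_gt0|exact: int_le].
    by rewrite -EFinM (wtD s (- (al * t)) n); congr EFin; ring.
  have e0 : 0 < s - al * t by rewrite subr_gt0.
  have C20 : 0 <= C2.
    have e1 : 0 < al * ka - s by rewrite subr_gt0.
    by rewrite /C2 !addr_ge0// ?ltW// !mulr_gt0// ?invr_gt0 ?subr_gt0 ?wt_lt1 ?wt_gt0.
  apply: (@le_lt_trans _ _ (C2 * (1 - wt (s - al * t) 1)^-1)%:E); last exact: ltry.
  apply: lime_le.
    by apply: is_cvg_nneseries => n _ _; rewrite lee_fin mulr_ge0// ltW// wt_gt0.
  near=> n; rewrite sumEFin lee_fin big_mkord -mulr_sumr ler_wpM2l//.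
  exact: wt_sum.
have pot_ge0 l : (0 <= pot l)%E by apply: nneseries_ge0 => n _ _; exact: term_ge0.
have mpot : measurable_fun setT pot.
  by apply: ge0_emeasurable_sum => // n l _ _; exact: term_ge0.
have /integrable_ae : P.-integrable setT pot.
  apply/integrableP; split => //.
  by under eq_integral do rewrite gee0_abs//.
move=> /(_ measurableT); apply: filterS => l /(_ I) pl.
have xE n : xsection (A n) l =
    [set uv : Om * Om | mdist (F (l, uv.1)) (F (l, uv.2)) < wt al n].
  by apply/seteqP; split => uv; rewrite /xsection /= inE.
apply: (@mass_distribution _ _ _ nu _ (fun u => F (l, u)) al t) => //.
  by move=> n; rewrite -xE; exact: measurable_xsection.
rewrite (eq_eseriesr (g := fun n => (wt (- (al * t)) n)%:E *
  (nu \x nu) (xsection (A n) l))%E).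
  by rewrite -/(pot l) -ge0_fin_numE.
by move=> n _; rewrite xE.
Unshelve. all: by end_near.
Qed.

End ae_dimension.

(** * Limit measures *)

Lemma ultra_cvg_bounded {R : realType} (F : set_system nat) (g : nat -> R) (a c : R) :
  UltraFilter F -> (forall n, a <= g n <= c) -> exists l : R, g n @[n --> F] --> l.
Proof.
move=> UF gb; have PF : ProperFilter F := ultra_proper.
have Fac : F (g @^-1` `[a, c]%classic).
  by apply: filterE => n; rewrite /= in_itv/=; exact: gb.
have [l [_ cl]] := @segment_compact R a c (g @ F) _ Fac.
exists l => A lA; have [//|FA] := in_ultra_setVsetC (g @^-1` A) UF.
have [x [/= nAx Ax]] := cl (~` A) A FA lA.
by case: nAx.
Qed.

Lemma generated_preimage {Om T : Type} (G : set (set Om)) (g : Om -> T)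
    (S : set (set T)) :
  sigma_algebra setT G -> (forall A, S A -> G (g @^-1` A)) ->
  forall B, <<s S >> B -> G (g @^-1` B).
Proof.
move=> [G0 GC GU] gS B BS.
apply: (BS [set A | G (g @^-1` A)]); split; [split|exact: gS].
- by rewrite /= preimage_set0.
- by move=> A GA; rewrite /= setTD preimage_setC -setTD; exact: GC.
- by move=> A GA; rewrite /= preimage_bigcup; exact: GU.
Qed.

Section uniform.
Context {R : realType}.

Definition leb01 : probability (measurableTypeR R) R := uniform_prob (@ltr01 R).

Lemma leb01_itv (x y : R) : 0 <= x -> x <= y -> y <= 1 ->
  leb01 `[x, y[%classic = (y - x)%:E.
Proof.
move=> x0 xy y1; rewrite /leb01 /= /uniform_prob.
rewrite (eq_integral (cst 1%E)); last first.
  move=> z; rewrite inE/= in_itv/= => /andP[xz zy]; rewrite /uniform_pdf.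
  by rewrite (le_trans x0 xz) (le_trans (ltW zy) y1)/= subr0 invr1.
rewrite integral_cst//= mul1e lebesgue_measure_itv/= lte_fin.
case: ltP => xy'; first by rewrite EFinB.
have -> : y = x by apply/eqP; rewrite eq_le xy xy'.
by rewrite subrr.
Qed.

End uniform.

(** * Nested intervals with prescribed lengths *)

Section tree.
Context {R : realType}.
Variables (b : nat -> nat) (m : seq nat -> R).
Hypotheses (m_ge0 : forall l, 0 <= m l) (m_nil : m [::] = 1).
Hypothesis m_cons : forall l, m l = \sum_(c < (b (size l)).+1) m (nat_of_ord c :: l).

(* Addresses are stored in reverse order: the last letter comes first. *)
Fixpoint adm (l : seq nat) : bool :=
  if l is c :: l' then (c <= b (size l'))%N && adm l' else true.

(** The intervals of the children of a node lie side by side, in the order of the new letter; by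
    [m_cons] they fill the interval of the node. *)
Fixpoint left_end (l : seq nat) : R :=
  if l is c :: l' then left_end l' + \sum_(c' < c) m (nat_of_ord c' :: l') else 0.

Definition cell l : set R := `[left_end l, left_end l + m l[%classic.

Let S l c := \sum_(c' < c) m (nat_of_ord c' :: l).

Let S_le l c c' : (c <= c')%N -> S l c <= S l c'.
Proof.
elim: c' => [|c' IH]; first by rewrite leqn0 => /eqP ->.
rewrite leq_eqVlt => /orP[/eqP -> //|cc']; apply: le_trans (IH cc') _.
by rewrite /S big_ord_recr/= lerDl.
Qed.

Let cellE c l x : cell (c :: l) x <-> left_end l + S l c <= x < left_end l + S l c.+1.
Proof. by rewrite /cell/= in_itv/= /S big_ord_recr/= addrA. Qed.

Lemma cell_sub c l : (c <= b (size l))%N -> cell (c :: l) `<=` cell l.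
Proof.
move=> cb x /cellE /andP[x1 x2]; rewrite /cell/= in_itv/= m_cons -/(S l _).
apply/andP; split.
  by apply: le_trans x1; rewrite lerDl /S sumr_ge0.
by apply: lt_le_trans x2 _; rewrite lerD2l; apply: S_le.
Qed.

Lemma cell_split l x : cell l x -> exists2 c, (c <= b (size l))%N & cell (c :: l) x.
Proof.
rewrite /cell/= in_itv/= m_cons -/(S l _) => /andP[x1 x2].
have exc : exists c, x < left_end l + S l c.+1 by exists (b (size l)).
case: (ex_minnP exc) => c xc cmin; exists c; first exact: cmin.
apply/cellE; rewrite xc andbT.
case: c xc cmin => [|c] xc cmin; first by rewrite /S big_ord0 addr0.
by rewrite leNgt; apply/negP => /cmin; rewrite ltnn.
Qed.

Lemma cell_inj l l' x : size l = size l' -> adm l -> adm l' ->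
  cell l x -> cell l' x -> l = l'.
Proof.
elim: l l' => [|c l IH] [|c' l'] //= [sl] /andP[cb al] /andP[cb' al'] xl xl'.
have ll' := IH l' sl al al' (cell_sub cb xl) (cell_sub cb' xl').
subst l'; congr (_ :: _).
move: xl xl' => /cellE /andP[x1 x2] /cellE /andP[x1' x2'].
have [cc|cc|//] := ltngtP c c'.
- by exfalso; have := S_le l cc; lra.
- by exfalso; have := S_le l cc; lra.
Qed.

Lemma cell_sub_nil l : adm l -> cell l `<=` cell [::].
Proof.
by elim: l => [_ x|c l IH /= /andP[cb al] x /(cell_sub cb)]; [|exact: IH].
Qed.

Lemma cell_bounds l : adm l -> 0 <= left_end l /\ left_end l + m l <= 1.
Proof.
elim: l => [_|c l IH /= /andP[cb /IH [l0 l1]]]; first by rewrite /= m_nil add0r.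
split; first by rewrite addr_ge0// sumr_ge0.
apply: le_trans l1; rewrite (m_cons l) -/(S l _) -/(S l _) -addrA lerD2l.
have -> : S l c + m (c :: l) = S l c.+1 by rewrite /S big_ord_recr.
exact: S_le.
Qed.

Lemma leb01_cell l : adm l -> leb01 (cell l) = (m l)%:E.
Proof.
move=> /cell_bounds [l0 l1]; rewrite leb01_itv//; last by rewrite lerDl.
by rewrite addrC addKr.
Qed.

Lemma branches : exists br : R -> nat -> seq nat, forall x, cell [::] x -> forall i,
  [/\ size (br x i) = i, adm (br x i), cell (br x i) x &
    exists2 c, (c <= b i)%N & br x i.+1 = c :: br x i].
Proof.
have /choice [nxt nxtP] : forall xl : R * seq nat, exists c, cell xl.2 xl.1 ->
    (c <= b (size xl.2))%N /\ cell (c :: xl.2) xl.1.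
  move=> [x l]; have [xl|nxl] := pselect (cell l x); last by exists 0%N.
  by have [c cb xc] := cell_split xl; exists c.
pose br x := fix br i := if i is i'.+1 then nxt (x, br i') :: br i' else [::].
exists br => x x0 i.
have [si ai xi] : [/\ size (br x i) = i, adm (br x i) & cell (br x i) x].
  elim: i => [//|i [si ai xi]]; have [cb xc] := nxtP (x, br x i) xi.
  by split => /=; [rewrite si|rewrite cb|].
split => //; exists (nxt (x, br x i)) => //.
by have [cb _] := nxtP (x, br x i) xi; rewrite si in cb.
Qed.

Fixpoint level i : seq (seq nat) :=
  if i is i'.+1 then [seq c :: l | l <- level i', c <- iota 0 (b i').+1] else [:: [::]].

Lemma mem_level i l : (l \in level i) = (size l == i) && adm l.
Proof.
elim: i l => [|i IH] l; first by rewrite inE; case: l.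
apply/allpairsP/idP => [[[l' c] [l'i ci ->]]|].
  move: l'i ci; rewrite IH mem_iota add0n ltnS => /andP[/eqP si al] /= ci.
  by rewrite si eqxx ci al.
case: l => [//|c l] /= /andP[/eqP[si] /andP[cb al]].
exists (l, c); split => //=; first by rewrite IH si eqxx al.
by have := mem_iota 0 (b i).+1 c; rewrite add0n ltnS -{2}si cb /= => ->.
Qed.

End tree.

Lemma measure_bigcup_seq_le {R : realType} {d} {T : measurableType d}
    (mu : {measure set T -> \bar R}) (I : eqType) (s : seq I) (A : I -> set T) :
  (forall i, i \in s -> measurable (A i)) ->
  measurable [set x | exists2 i, i \in s & A i x] /\
  (mu [set x | exists2 i, i \in s & A i x] <= \sum_(i <- s) mu (A i))%E.
Proof.
elim: s => [_|i s IH mA].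
  rewrite (_ : [set _ | _] = set0); last by apply/seteqP; split => x // [].
  by rewrite measure0 big_nil.
have [ms IHs] : measurable [set x | exists2 i, i \in s & A i x] /\
    (mu [set x | exists2 i, i \in s & A i x] <= \sum_(i <- s) mu (A i))%E.
  by apply: IH => j js; apply: mA; rewrite inE js orbT.
have mi : measurable (A i) by apply: mA; rewrite inE eqxx.
rewrite (_ : [set _ | _] = A i `|` [set x | exists2 i, i \in s & A i x]).
  split; first exact: measurableU.
  by rewrite big_cons; apply: le_trans (measureU2 _ _ _) _ => //; exact: leeD2l.
apply/seteqP; split => [x [j]|x [Ai|[j js Aj]]].
- by rewrite inE => /orP[/eqP -> ?|js Aj]; [left|right; exists j].
- by exists i => //; rewrite inE eqxx.
- by exists j => //; rewrite inE js orbT.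
Qed.

Lemma cvg_sumr {R : realType} {J I : Type} (F : set_system I) {FF : Filter F}
    (r : seq J) (g : J -> I -> R) (l : J -> R) :
  (forall j, g j i @[i --> F] --> l j) ->
  \sum_(j <- r) g j i @[i --> F] --> \sum_(j <- r) l j.
Proof. by move=> gl; apply: cvg_big => //; exact: add_continuous. Qed.

Section limit_measure.
Context {R : realType} {W Z : metricType R}.
Variables (f : W -> Z) (e : nat -> W) (adr : nat -> W -> nat) (b : nat -> nat).
Variables (nu : nat -> seq (R * W)) (B : nat -> R).
Hypothesis Wcomplete : complete_space W.
Hypothesis Zsep : separable_space Z.
Hypothesis f_cont : continuous f.
Hypothesis adrP : forall i x, mdist x (e (adr i x)) < rad i.
Hypothesis nu_ge0 : forall j p, p \in nu j -> 0 <= p.1.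
Hypothesis nu_adr : forall j p i, p \in nu j -> (i < j)%N -> (adr i p.2 <= b i)%N.
Hypothesis nu_sum : forall j, \sum_(p <- nu j) p.1 = 1.
Hypothesis nu_pairs : forall j k, (k < j)%N ->
  \sum_(p <- nu j) \sum_(q <- nu j) p.1 * q.1 * close k (f p.2) (f q.2) <= B k.

(** The points whose [adr 0], [adr 1], ... spell [l], read from its end. *)
Fixpoint cyl (l : seq nat) (x : W) : bool :=
  if l is c :: l' then (adr (size l') x == c) && cyl l' x else true.

Let mass j l : R := \sum_(p <- nu j) p.1 * (cyl l p.2)%:R.

Let mass_ge0 j l : 0 <= mass j l.
Proof.
by rewrite /mass big_seq sumr_ge0// => p pj; rewrite mulr_ge0//; exact: nu_ge0 pj.
Qed.

Let mass_le1 j l : mass j l <= 1.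
Proof.
rewrite -(nu_sum j) /mass big_seq [leRHS]big_seq; apply: ler_sum => p pj.
by rewrite -[leRHS]mulr1 ler_wpM2l ?(nu_ge0 pj)// lern1 leq_b1.
Qed.

(** At a level below [j], the points of [nu j] have letters at most [b (size l)], so finitely many
    children exhaust the mass of the cylinder. In the limit this holds at all levels. *)
Let mass_cons j l : (size l < j)%N ->
  mass j l = \sum_(c < (b (size l)).+1) mass j (nat_of_ord c :: l).
Proof.
move=> lj; rewrite /mass exchange_big/= big_seq [RHS]big_seq.
apply: eq_bigr => p pj; rewrite -mulr_sumr; congr (_ * _).
have ab := nu_adr pj lj; rewrite -ltnS in ab.
rewrite (bigD1 (Ordinal ab))//= eqxx andTb big1 ?addr0// => c cn.
case: eqP => //= ac; case/eqP: cn; exact/val_inj.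
Qed.

Lemma same_cyl l x y : cyl l x -> cyl l y -> (0 < size l)%N ->
  mdist x y <= 2 * rad (size l).-1.
Proof.
case: l => [//|c l] /= /andP[/eqP xc _] /andP[/eqP yc _] _.
have := adrP (size l) x; have := adrP (size l) y; rewrite xc yc.
have := metric_triangle x (e c) y; rewrite (metric_sym (e c)); lra.
Qed.

Lemma cyl_inj l l' x : size l = size l' -> cyl l x -> cyl l' x -> l = l'.
Proof.
elim: l l' => [|c l IH] [|c' l'] //= [sl] /andP[/eqP <- lx] /andP[/eqP <- lx'].
by rewrite sl (IH l').
Qed.

(** The limits [m l] of the masses of the cylinders are additive along the tree, and [phi] sends the
    points of the interval of [l] close to the cylinder of [l]. The close pairs are exhausted by
    finite unions of products of intervals, for which the bound [B k] is inherited from the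
    [nu j]. *)
Lemma limit_measure : exists phi : R -> W,
  (forall O, open O -> measurable (phi @^-1` O : set (measurableTypeR R))) /\
  forall k, ((leb01 \x leb01) [set uv : measurableTypeR R * measurableTypeR R |
    (mdist (f (phi uv.1)) (f (phi uv.2)) < rad k.+2)%R] <= (B k)%:E)%E.
Proof.
have [F [UF Foo]] := ultraFilterLemma (F := \oo) _.
have PF : ProperFilter F by exact: ultra_proper.
have Fge N : F [set n | (N <= n)%N] by apply: Foo; exists N.
have /choice [m mP] : forall l, exists r : R, mass j l @[j --> F] --> r.
  move=> l; apply: (@ultra_cvg_bounded _ _ _ 0 1) => // j.
  by rewrite mass_ge0 mass_le1.
have m_ge0 l : 0 <= m l.
  by apply: (cvgr_to_ge (mP l)); apply: filterE => j; exact: mass_ge0.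
have m_nil : m [::] = 1.
  apply: (cvg_unique _ (mP [::])) => //.
  rewrite (_ : mass^~ [::] = cst 1); first exact: cvg_cst.
  by apply/funext => j; rewrite /mass /=; under eq_bigr do rewrite mulr1.
have m_cons l : m l = \sum_(c < (b (size l)).+1) m (nat_of_ord c :: l).
  apply: (cvg_unique _ (mP l)) => //.
  have : \sum_(c < (b (size l)).+1) mass j (nat_of_ord c :: l) @[j --> F] -->
      \sum_(c < (b (size l)).+1) m (nat_of_ord c :: l).
    by apply: cvg_sumr => c; exact: mP.
  apply: cvg_trans; apply: near_eq_cvg.
  by apply: filterS (Fge (size l).+1) => j /= lj; rewrite mass_cons.
pose I_ := cell m.
have [br brP] := branches m_cons.
have cyl_ex l x : I_ l x -> exists y, cyl l y.
  rewrite /I_ /cell /= in_itv/= => /andP[x1 x2].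
  have ml : 0 < m l by lra.
  apply: contrapT => nl; move: ml; rewrite ltNge => /negP; apply.
  apply: (cvgr_to_le (mP l)); apply: filterE => j.
  rewrite /mass big1// => p _; case E : (cyl l p.2); last by rewrite mulr0.
  by case: nl; exists p.2.
(* [phi x] is the limit of points of the cylinders along the branch of [x]; it may leave the
   cylinders but stays close to them. Outside [[0, 1[] it takes the default value [e 0]. *)
have /choice [phi phiP] : forall x, exists l, if `[< I_ [::] x >] then
    forall i y, cyl (br x i.+1) y -> mdist y l <= 4 * rad i else l = e 0.
  move=> x; case: asboolP => [x0|]; last by exists (e 0).
  have xB := brP x x0.
  have /choice [y yP] : forall i, exists y, cyl (br x i) y.
    by move=> i; have [_ _ /cyl_ex] := xB i.
  have cyl_le i j : (i <= j)%N -> cyl (br x i) (y j).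
    suff main n z : cyl (br x (i + n)%N) z -> cyl (br x i) z.
      by move=> ij; have := main (j - i)%N (y j); rewrite subnKC//; apply; exact: yP.
    elim: n => [|n IHn]; first by rewrite addn0.
    rewrite addnS; have [_ _ _ [c _ ->]] := xB (i + n)%N.
    by move=> /= /andP[_]; exact: IHn.
  have sz i : size (br x i) = i by have [] := xB i.
  have near_y i j z : (i < j)%N -> cyl (br x i.+1) z -> mdist z (y j) <= 2 * rad i.
    move=> ij zi; have := same_cyl zi (cyl_le _ _ ij).
    by rewrite sz; exact.
  have [l yl] : exists l : W, y n @[n --> \oo] --> l.
    apply: (Wcomplete (F := y @ \oo)); apply/cauchy_ballP => eps eps0.
    have [i ie] := @rad_small R (eps / 4) ltac:(lra).
    have yb j : (i < j)%N -> mdist (y i.+1) (y j) <= 2 * rad i.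
      by move=> ij; apply: near_y => //; exact: yP.
    near=> u v => /=.
    suff : mdist u v < eps by rewrite ballEmdist.
    have : mdist (y i.+1) u <= 2 * rad i by near: u; exists i.+1 => // j /= /yb.
    have : mdist (y i.+1) v <= 2 * rad i by near: v; exists i.+1 => // j /= /yb.
    by have := metric_triangle u (y i.+1) v; rewrite (metric_sym u (y i.+1)); lra.
  exists l => i z zi; apply/ler_addgt0Pr => eps eps0.
  have [N _ NP] : \forall n \near \oo, ball l eps (y n).
    by apply: yl; apply: nbhsx_ballx.
  have := NP (maxn N i.+1) (leq_maxl _ _); rewrite ballEmdist /= => ly.
  have := near_y i (maxn N i.+1) z (leq_maxr _ _) zi.
  have := metric_triangle z (y (maxn N i.+1)) l.
  by rewrite (metric_sym (y (maxn N i.+1)) l); have := @rad_gt0 R i; lra.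
have phi_in x i y : I_ [::] x -> cyl (br x i.+1) y -> mdist y (phi x) <= 4 * rad i.
  by move=> x0; have := phiP x; rewrite asboolT//; apply.
have phi_out x : ~ I_ [::] x -> phi x = e 0.
  by move=> x0; have := phiP x; rewrite asboolF.
have br_cell x l : adm b l -> I_ l x -> br x (size l) = l.
  move=> al xl; have x0 := cell_sub_nil m_ge0 m_cons al xl.
  have [sl abr xbr _] := brP x x0 (size l).
  exact: (cell_inj m_ge0 m_cons sl abr al xbr xl).
have mI l : measurable (I_ l : set (measurableTypeR R)) by exact: measurable_itv.
have mphi O : open O -> measurable (phi @^-1` O : set (measurableTypeR R)).
  move=> oO; rewrite -(setIT (phi @^-1` O)) -(setUv (I_ [::])) setIUr.
  apply: measurableU; last first.
    have [eO|neO] := pselect (O (e 0)).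
      rewrite (_ : _ `&` _ = ~` I_ [::]); first exact: measurableC.
      by apply/seteqP; split => [x []//|x nx]; split => //=; rewrite phi_out.
    rewrite (_ : _ `&` _ = set0); first exact: measurable0.
    by apply/seteqP; split => [x [/= Ox nx]|x []//]; rewrite phi_out in Ox.
  (* The preimage of [O] in [[0, 1[] is the union of the countably many intervals whose cylinder has
     its neighbourhood, of the radius allowed to [phi], inside [O]. *)
  pose good l := [/\ adm b l, (0 < size l)%N &
    forall y z, cyl l y -> mdist y z <= 4 * rad (size l).-1 -> O z].
  rewrite (_ : _ `&` _ = \bigcup_l (if `[< good l >] then I_ l else set0)).
    apply: countable_bigcupT_measurable; first exact: countableP.
    by move=> l; case: ifP => _; [exact: mI|exact: measurable0].
  apply/seteqP; split => [x [/= Ox x0]|x [l _]]; last first.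
    case: asboolP => // -[al l0 lO] xl.
    have x0 := cell_sub_nil m_ge0 m_cons al xl.
    split => //=; have [y ly] := cyl_ex _ _ xl; apply: (lO y) => //.
    by apply: phi_in => //; rewrite prednK// br_cell.
  have /nbhs_ballP [eps /= eps0 epsO] : nbhs (phi x) O by exact: open_nbhs_nbhs.
  have [i ie] := @rad_small R (eps / 8) ltac:(lra).
  have [si ai xi _] := brP x x0 i.+1.
  exists (br x i.+1) => //; rewrite asboolT//; split => //; first by rewrite si.
  rewrite si /= => y z yi yz; apply: epsO; rewrite ballEmdist/=.
  have := phi_in _ _ _ x0 yi; have := metric_triangle (phi x) y z.
  by rewrite (metric_sym (phi x) y); lra.
exists phi; split => // k.
set E := [set _ | _].
pose T2 := (measurableTypeR R * measurableTypeR R)%type.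
(* The pairs of cylinders of level [i] all of whose points have images closer than [rad k.+2]; they
   are finitely many, so the limit can be taken in their masses. *)
pose far i : seq (seq nat * seq nat) :=
  [seq ll <- undup [seq (l, l') | l <- level b i, l' <- level b i] |
    `[< forall y z, cyl ll.1 y -> cyl ll.2 z -> mdist (f y) (f z) < rad k.+2 >]].
have farP i ll : ll \in far i -> [/\ size ll.1 = i, size ll.2 = i, adm b ll.1,
    adm b ll.2 & forall y z, cyl ll.1 y -> cyl ll.2 z -> mdist (f y) (f z) < rad k.+2].
  rewrite mem_filter mem_undup => /andP[/asboolP llk /allpairsP[[l l'] [/= il il' lE]]].
  by move: il il' llk; rewrite lE !mem_level => /andP[/eqP ? ?] /andP[/eqP ? ?].
pose G i : set T2 := [set uv | exists2 ll, ll \in far i & (I_ ll.1 `*` I_ ll.2) uv].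
have mII ll : measurable (I_ ll.1 `*` I_ ll.2 : set T2) by exact: measurableX.
have mG i : measurable (G i).
  by have [] := measure_bigcup_seq_le (leb01 \x leb01)%E (s := far i)
    (A := fun ll => I_ ll.1 `*` I_ ll.2) (fun ll _ => mII ll).
have G_le i : ((leb01 \x leb01) (G i) <= (B k)%:E)%E.
  have [_] := measure_bigcup_seq_le (leb01 \x leb01)%E (s := far i)
    (A := fun ll => I_ ll.1 `*` I_ ll.2) (fun ll _ => mII ll).
  move/le_trans; apply.
  have -> : (\sum_(ll <- far i) (leb01 \x leb01) (I_ ll.1 `*` I_ ll.2) =
      (\sum_(ll <- far i) m ll.1 * m ll.2)%:E)%E.
    rewrite -sumEFin big_seq [RHS]big_seq; apply: eq_bigr => ll /farP[_ _ a1 a2 _].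
    rewrite [LHS]product_measure1E; [|exact: mI|exact: mI].
    have E1 := leb01_cell m_ge0 m_nil m_cons a1.
    have E2 := leb01_cell m_ge0 m_nil m_cons a2.
    by rewrite EFinM; exact: (congr2 (fun x y => x * y)%E E1 E2).
  rewrite lee_fin.
  have : \sum_(ll <- far i) mass j ll.1 * mass j ll.2 @[j --> F] -->
      \sum_(ll <- far i) m ll.1 * m ll.2.
    by apply: cvg_sumr => ll; apply: cvgM; exact: mP.
  move/cvgr_to_le; apply; apply: filterS (Fge k.+1) => j /= kj.
  apply: le_trans (nu_pairs kj).
  (* Before the limit, a pair of points lies in at most one product of cylinders of level [i], and
     [close k] is [1] on those of [far i]. *)
  have -> : \sum_(ll <- far i) mass j ll.1 * mass j ll.2 =
      \sum_(p <- nu j) \sum_(q <- nu j) p.1 * q.1 *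
        \sum_(ll <- far i) (cyl ll.1 p.2 && cyl ll.2 q.2)%:R.
    under [RHS]eq_bigr do under eq_bigr do rewrite mulr_sumr.
    under [RHS]eq_bigr do rewrite exchange_big/=.
    rewrite [RHS]exchange_big/=; apply: eq_bigr => ll _.
    rewrite /mass mulr_suml; apply: eq_bigr => p _; rewrite mulr_sumr.
    by apply: eq_bigr => q _; rewrite -mulnb natrM; ring.
  rewrite big_seq [leRHS]big_seq; apply: ler_sum => p pj.
  rewrite big_seq [leRHS]big_seq; apply: ler_sum => q qj.
  apply: ler_wpM2l; first by rewrite mulr_ge0// (nu_ge0 pj, nu_ge0 qj).
  rewrite /close; case: ltP => pq.
    apply: (@sum_indic_le1 _ _ _ (fun ll => cyl ll.1 p.2 && cyl ll.2 q.2)).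
      by rewrite filter_uniq// undup_uniq.
    move=> [l1 l2] [l1' l2'] /farP[/= s1 s2 _ _ _] /farP[/= s1' s2' _ _ _].
    move=> /andP[c1 c2] /andP[c1' c2'].
    have -> := cyl_inj (etrans s1 (esym s1')) c1 c1'.
    by have -> := cyl_inj (etrans s2 (esym s2')) c2 c2'.
  rewrite big_seq big1// => ll /farP[_ _ _ _ llk].
  case: (boolP (_ && _)) => // /andP[c1 c2].
  by have := llk _ _ c1 c2; rewrite ltNge pq.
have Gmono : {homo G : n n' / (n <= n')%N >-> (n <= n')%O}.
  apply/nondecreasing_seqP => i; apply/subsetPset => -[u v] [[l l'] /farP[/= s1 s2 a1 a2 llk] [/= ul vl']].
  have [c cb uc] := cell_split m_cons ul; have [c' cb' vc] := cell_split m_cons vl'.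
  exists (c :: l, c' :: l') => //; rewrite mem_filter mem_undup; apply/andP; split.
    by apply/asboolP => y z /= /andP[_ yl] /andP[_ zl']; exact: llk.
  apply/allpairsP; exists (c :: l, c' :: l'); split => //; rewrite mem_level /=.
    by rewrite s1 eqxx -?s1 cb a1.
  by rewrite s2 eqxx -?s2 cb' a2.
pose N : set T2 := (~` I_ [::] `*` setT) `|` (setT `*` ~` I_ [::]).
have I0 : leb01 (~` I_ [::]) = 0%E.
  by rewrite probability_setC// /I_ (leb01_cell m_ge0 m_nil m_cons)// m_nil subee.
have mN : measurable N.
  by apply: measurableU; apply: measurableX => //; exact: measurableC.
have mI0 : measurable (~` I_ [::] : set (measurableTypeR R)) by exact: measurableC.
have NA : ((leb01 \x leb01) (~` I_ [::] `*` setT) = 0)%E.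
  rewrite [LHS]product_measure1E//.
  exact: etrans (congr1 (fun x => x * _)%E I0) (mul0e _).
have NB : ((leb01 \x leb01) (setT `*` ~` I_ [::]) = 0)%E.
  rewrite [LHS]product_measure1E//.
  exact: etrans (congr1 (fun x => _ * x)%E I0) (mule0 _).
have N0 : ((leb01 \x leb01) N = 0)%E.
  apply/eqP; rewrite eq_le measure_ge0 andbT.
  apply: le_trans (measureU2 _ _ _) _.
  - by apply: measurableX => //; exact: measurableC.
  - by apply: measurableX => //; exact: measurableC.
  - by rewrite [X in (X + _)%E]NA [X in (_ + X)%E]NB adde0.
(* The inequality defining [E] is strict and [f] is continuous at [phi u] and [phi v], so deep
   enough cylinders along the two branches form a pair of [far]. *)
have EG : E `<=` N `|` \bigcup_i G i.
  move=> [u v] /= uv.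
  have [u0|nu0] := pselect (I_ [::] u); last by left; left.
  have [v0|nv0] := pselect (I_ [::] v); last by left; right.
  right.
  pose eps := (rad k.+2 - mdist (f (phi u)) (f (phi v))) / 2.
  have eps0 : 0 < eps by rewrite /eps divr_gt0// subr_gt0.
  have cont w : exists i, forall y, mdist y (phi w) <= 4 * rad i ->
      mdist (f (phi w)) (f y) < eps.
    have /nbhs_ballP [r /= r0 rP] : nbhs (phi w) (f @^-1` ball (f (phi w)) eps).
      by apply: f_cont; apply: nbhsx_ballx.
    have [i ir] := @rad_small R (r / 4) ltac:(lra).
    exists i => y yw; have := rP y; rewrite ballEmdist /= ballEmdist /=; apply.
    by rewrite metric_sym; lra.
  have [iu iuP] := cont u; have [iv ivP] := cont v.
  pose i := maxn iu iv.
  have [s1 a1 x1 _] := brP u u0 i.+1; have [s2 a2 x2 _] := brP v v0 i.+1.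
  exists i.+1 => //; exists (br u i.+1, br v i.+1) => //.
  rewrite mem_filter mem_undup; apply/andP; split; last first.
    apply/allpairsP; exists (br u i.+1, br v i.+1).
    by split => //; rewrite mem_level (s1, s2) eqxx.
  apply/asboolP => y z /= yu zv.
  have := iuP y; have := ivP z.
  have ri1 : rad i <= rad iu :> R by apply: rad_le; exact: leq_maxl.
  have ri2 : rad i <= rad iv :> R by apply: rad_le; exact: leq_maxr.
  have py := phi_in _ _ _ u0 yu; have pz := phi_in _ _ _ v0 zv.
  move=> /(_ ltac:(lra)) fz /(_ ltac:(lra)) fy.
  have := metric_triangle (f y) (f (phi u)) (f z).
  have := metric_triangle (f (phi u)) (f (phi v)) (f z).
  by rewrite (metric_sym (f y) (f (phi u))); move: fz fy; rewrite /eps; lra.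
have mfphi : forall Q, borel Q ->
    measurable ((fun u => f (phi u)) @^-1` Q : set (measurableTypeR R)).
  apply: (generated_preimage (S := @open Z)) => [|O oO].
    exact: sigma_algebra_measurable.
  by apply: (mphi (f @^-1` O)); move/continuousP: f_cont; apply.
have mE : measurable (E : set T2).
  apply: (@measurable_close _ _ _ T2 (fun uv => f (phi uv.1)) (fun uv => f (phi uv.2))) => // Q bQ.
    rewrite -[X in measurable X]setTI; apply: (measurable_fst _ _ (mfphi Q bQ)) => //.
  rewrite -[X in measurable X]setTI; apply: (measurable_snd _ _ (mfphi Q bQ)) => //.
have mUG : measurable (\bigcup_i G i) by exact: bigcupT_measurable.
apply: (@le_trans _ _ ((leb01 \x leb01) (N `|` \bigcup_i G i))%E).
  by apply: le_measure; rewrite ?inE//; exact: measurableU.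
apply: le_trans (measureU2 _ mN mUG) _; rewrite [X in (X + _)%E]N0 add0e.
have cv := nondecreasing_cvg_mu (mu := (leb01 \x leb01)%E) mG mUG Gmono.
apply: (cvge_to_le cv).
by apply: nearW => i; exact: G_le.
Unshelve. all: by end_near.
Qed.

End limit_measure.

(** * Frostman's lemma and the theorem *)

Lemma le_hausdorff_measure {R : realType} {T : metricType R} (s : R) (A B : set T) :
  A `<=` B -> (hausdorff_measure s A <= hausdorff_measure s B)%E.
Proof.
move=> AB; apply: ge_ereal_sup => _ [delta delta0 <-].
apply: (@le_trans _ _ (hausdorff_content s delta B)); last first.
  by apply: ereal_sup_ubound; exists delta.
apply: le_ereal_inf_tmp => _ [F [BF Fd] <-].
by apply: ereal_inf_lbound; exists F => //; split => //; exact: subset_trans BF.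
Qed.

Lemma hausdorff_dim_ge0 {R : realType} {T : metricType R} (A : set T) :
  (0 <= hausdorff_dim A)%E.
Proof. by apply: ereal_sup_ubound; left. Qed.

Lemma gt0_hausdorff_measure_dim {R : realType} {T : metricType R} (s : R) (A : set T) :
  0 <= s -> (0 < hausdorff_measure s A)%E -> (s%:E <= hausdorff_dim A)%E.
Proof. by move=> s0 sA; apply: ereal_sup_ubound; right; exists s. Qed.

Lemma dense_sequence {R : realType} {W : metricType R} : separable_space W -> W ->
  exists e : nat -> W, forall x (r : R), 0 < r -> exists c, mdist x (e c) < r.
Proof.
move=> [D /countable_injP [g ginj] Ddense] w0.
have /choice [e eP] : forall c, exists w, forall y, D y -> g y = c -> w = y.
  move=> c; have [[y [Dy yc]]|ny] := pselect (exists y, D y /\ g y = c).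
    by exists y => z Dz zc; apply: ginj; rewrite ?inE// yc zc.
  by exists w0 => y Dy yc; case: ny; exists y.
exists e => x r r0.
have [|y [/= xy Dy]] := Ddense _ _ (open_mball x r).
  by exists x; rewrite /= mdistxx.
by exists (g y); rewrite (eP _ y).
Qed.

(* The measure is the image of [leb01] by [f \o phi]; its Frostman condition
   holds on average, with exponent [u] instead of [s]. *)
Lemma frostman {R : realType} {W Z : metricType R} (f : W -> Z) (s u : R) :
  complete_space W -> separable_space W -> separable_space Z -> continuous f ->
  0 < u -> u < s -> (0 < hausdorff_measure s (range f))%E ->
  exists (phi : R -> W) (C : R), [/\ 0 < C,
    forall O, open O -> measurable (phi @^-1` O : set (measurableTypeR R)) &
    forall k, ((leb01 \x leb01) [set uv : measurableTypeR R * measurableTypeR R |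
      (mdist (f (phi uv.1)) (f (phi uv.2)) < rad k.+2)%R] <= (C * wt u k)%:E)%E].
Proof.
move=> Wcomplete Wsep Zsep fcont u0 us Hs.
have s0 : 0 < s by lra.
have cX := content_gt0 s0 Hs.
have [a a0 aX] : exists2 a : R, 0 < a & (a%:E < content (wt s) 0 (range f))%E.
  case: (content _ _ _) cX => [c| |]// c0; last by exists 1 => //; exact: ltry.
  by exists (c / 2); rewrite ?lte_fin; move: c0; rewrite lte_fin; lra.
(* Half of the gap between [u] and [s] is spent on [content_selection], the other half on
   [energy_bound]. *)
pose t := (u + s) / 2.
have t0 : 0 < t by rewrite /t; lra.
have ts : t < s by rewrite /t; lra.
have ut : u < t by rewrite /t; lra.
have [w0 _] : exists w : W, True.
  apply: contrapT => nW; move: cX; apply/negP; rewrite -leNgt.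
  apply: le_trans (content_le (U := set0) _ _) _; last by rewrite /cost esum_set0.
  by split => [p []|z [w _ _]]; case: nW; exists w.
have [e eP] := dense_sequence Wsep w0.
have /choice [adr0 adr0P] : forall ix : nat * W, exists c, mdist ix.2 (e c) < rad ix.1.
  by move=> [i x]; apply: eP; exact: rad_gt0.
pose adr i x := adr0 (i, x).
have [b bP] := content_selection adr Zsep t0 ts aX.
have [C C0 CP] := @energy_bound R Z t u a u0 ut a0.
have /choice [nu nuP] : forall j, exists nu : seq (R * W), [/\
    forall p, p \in nu -> 0 <= p.1,
    forall p i, p \in nu -> (i < j)%N -> (adr i p.2 <= b i)%N,
    \sum_(p <- nu) p.1 = 1 &
    forall k, (k < j)%N -> \sum_(p <- nu) \sum_(q <- nu)
      p.1 * q.1 * close k (f p.2) (f q.2) <= C * wt u k].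
  move=> j; have [nu [nuA nu1] nuk] := CP _ j (bP j).
  (* The measures found on [Z] are lifted to [W] by choosing preimages with bounded addresses. *)
  have /choice [g gP] : forall z, exists w, (f @` [set x | forall i, (i < j)%N ->
      (adr i x <= b i)%N]) z -> (forall i, (i < j)%N -> (adr i w <= b i)%N) /\ f w = z.
    move=> z; have [[w wj <-]|nz] := pselect ((f @` [set x | forall i, (i < j)%N ->
      (adr i x <= b i)%N]) z); first by exists w.
    by exists w0 => /nz.
  exists [seq (p.1, g p.2) | p <- nu]; split.
  - by move=> p /mapP[q /nuA[q0 _] ->].
  - by move=> p i /mapP[q /nuA[_ /gP[qi _]] ->] ij /=; exact: qi.
  - by rewrite big_map.
  - move=> k kj; apply: le_trans (nuk k kj); rewrite /pair_mass big_map.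
    rewrite big_seq [leRHS]big_seq; apply: ler_sum => p /nuA[_ /gP[_ gp]].
    rewrite big_map big_seq [leRHS]big_seq; apply: ler_sum => q /nuA[_ /gP[_ gq]].
    by rewrite /= gp gq.
have [|||||phi [mphi phik]] := @limit_measure R W Z f e adr b nu
    (fun k => C * wt u k) Wcomplete Zsep fcont.
- by move=> i x; exact: (adr0P (i, x)).
- by move=> j p pj; have [+ _ _ _] := nuP j; apply.
- by move=> j p i pj; have [_ + _ _] := nuP j; apply.
- by move=> j; have [] := nuP j.
- by move=> j k; have [_ _ _] := nuP j; apply.
by exists phi, C.
Qed.

Lemma ae_hausdorff_measure_gt0 (R : realType)
  (Z : metricType R) (Zseparable : separable_space Z)
  (X : set Z) (Xanalytic : analytic X)
  (Y : metricType R) (Yseparable : separable_space Y)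
  (d : measure_display) (L : measurableType d) (P : probability L R)
  (proj : L * X -> Y)
  (proj_measurable :
    sigma_measurable (prod_sigma (@measurable d L) (@borel X)) (@borel Y) proj)
  (alpha kappa C : R) (alpha_gt0 : 0 < alpha) (kappa_gt0 : 0 < kappa)
  (C_gt0 : 0 < C)
  (transversality : forall delta : R, 0 < delta ->
    forall x1 x2 : X, x1 <> x2 ->
    (P [set l | (mdist (proj (l, x1)) (proj (l, x2)) <=
                  delta * mdist (set_val x1) (set_val x2) `^ alpha)%R]
      <= (C * delta `^ kappa)%:E)%E)
  (t : R) (t_gt0 : 0 < t) (t_kappa : t < kappa)
  (t_dim : ((alpha * t)%:E < hausdorff_dim X)%E) :
  {ae P, forall l : L,
    (0 < hausdorff_measure t (range (fun x : X => proj (l, x))))%E}.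
Proof.
have at0 : 0 < alpha * t by exact: mulr_gt0.
have [s [Hs ats]] : exists s, (0 < hausdorff_measure s X)%E /\ alpha * t < s.
  have [_ [->|[s [s0 Hs] <-]]] := ereal_sup_gt t_dim.
    by rewrite lte_fin ltNge ltW.
  by rewrite lte_fin => ats; exists s.
(* The gap [u < s] is the loss in [frostman], [u < alpha * kappa] makes the average over [l] of
   order [wt u n], and [alpha * t < u] makes the energy converge. *)
have [u [u_at us uk]] : exists u, [/\ alpha * t < u, u < s & u < alpha * kappa].
  have ak : alpha * t < alpha * kappa by rewrite ltr_pM2l.
  have : alpha * t < Num.min s (alpha * kappa) by rewrite lt_min ats.
  exists ((alpha * t + Num.min s (alpha * kappa)) / 2).
  have m1 : Num.min s (alpha * kappa) <= s by rewrite ge_min lexx.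
  have m2 : Num.min s (alpha * kappa) <= alpha * kappa by rewrite ge_min lexx orbT.
  by split; lra.
have [W [Wcomplete Wsep [f fcont fX]]] := Xanalytic.
have [||phi [C1 [C1_gt0 mphi phik]]] :=
  @frostman R W Z f s u Wcomplete Wsep Zseparable fcont _ us.
- by lra.
- by rewrite fX.
have fphiX x : f (phi x) \in X by rewrite inE -fX; exists (phi x).
pose psi x : X := exist _ (f (phi x)) (fphiX x).
have mpsi B : borel B -> measurable (psi @^-1` B : set (measurableTypeR R)).
  apply: (generated_preimage (S := @open X)) => [|_ [V oV <-]].
    exact: sigma_algebra_measurable.
  by apply: (mphi (f @^-1` V)); move/continuousP: fcont; apply.
have mfphi Q : borel Q ->
    measurable ((fun x => f (phi x)) @^-1` Q : set (measurableTypeR R)).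
  apply: (generated_preimage (S := @open Z)) => [|O oO].
    exact: sigma_algebra_measurable.
  by apply: (mphi (f @^-1` O)); move/continuousP: fcont; apply.
pose F (lx : L * measurableTypeR R) := proj (lx.1, psi lx.2).
pose rho (uv : measurableTypeR R * measurableTypeR R) :=
  mdist (f (phi uv.1)) (f (phi uv.2)).
have mF B : borel B -> measurable (F @^-1` B).
  move=> bB; have := proj_measurable _ bB.
  apply: (@generated_preimage _ _ _ (fun lx => (lx.1, psi lx.2)) _ _ _ (proj @^-1` B)).
    exact: sigma_algebra_measurable.
  move=> _ [A mA [Q bQ <-]].
  rewrite (_ : _ @^-1` _ = A `*` (psi @^-1` Q)).
    by apply: measurableX => //; exact: mpsi.
  by apply/seteqP; split.
have mrho r : measurable [set uv | rho uv < r].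
  apply: (measurable_close (f := fun uv => f (phi uv.1)) (g := fun uv => f (phi uv.2))) => // Q bQ.
    by rewrite -[X in measurable X]setTI; apply: (measurable_fst _ _ (mfphi Q bQ)).
  by rewrite -[X in measurable X]setTI; apply: (measurable_snd _ _ (mfphi Q bQ)).
have ae := @ae_positive_measure R _ _ L (measurableTypeR R) P leb01 Y F rho u t
  alpha kappa C C1 alpha_gt0 kappa_gt0 C_gt0 t_gt0 u_at uk C1_gt0 Yseparable mF mrho
  phik.
apply: filterS (ae _) => [l|delta delta0 [v w] vw].
  move/lt_le_trans; apply; apply: le_hausdorff_measure => _ [v _ <-].
  by exists (psi v).
apply: (transversality delta delta0 (psi v) (psi w)) => psivw.
move: vw; rewrite /rho /= -[f (phi v)]/(set_val (psi v)) -[f (phi w)]/(set_val (psi w)).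
by rewrite psivw mdistxx ltxx.
Qed.

Theorem theorem1p1 (R : realType)
  (Z : metricType R) (Zcomplete : complete_space Z) (Zseparable : separable_space Z)
  (X : set Z) (Xanalytic : analytic X)
  (Y : metricType R) (Yseparable : separable_space Y)
  (d : measure_display) (L : measurableType d) (P : probability L R)
  (proj : L * X -> Y)
  (proj_measurable :
    sigma_measurable (prod_sigma (@measurable d L) (@borel X)) (@borel Y) proj)
  (alpha kappa C : R) (alpha_gt0 : 0 < alpha) (kappa_gt0 : 0 < kappa)
  (C_gt0 : 0 < C)
  (transversality : forall delta : R, 0 < delta ->
    forall x1 x2 : X, x1 <> x2 ->
    (P [set l | (mdist (proj (l, x1)) (proj (l, x2)) <=
                  delta * mdist (set_val x1) (set_val x2) `^ alpha)%R]
      <= (C * delta `^ kappa)%:E)%E) :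
  {ae P, forall l : L,
    (mine kappa%:E (hausdorff_dim X * (alpha^-1)%:E)
       <= hausdorff_dim (range (fun x : X => proj (l, x))))%E}.
Proof.
have i0 : (0 <= (alpha^-1)%:E :> \bar R)%E by rewrite lee_fin invr_ge0 ltW.
set dm := mine _ _.
have dm0 : (0 <= dm)%E.
  by rewrite /dm le_min lee_fin ltW//= mule_ge0// hausdorff_dim_ge0.
have dmk : (dm <= kappa%:E)%E by rewrite /dm ge_min lexx.
have dmX : (dm <= hausdorff_dim X * (alpha^-1)%:E)%E by rewrite /dm ge_min lexx orbT.
(* The minimum is at most [kappa], hence real even if [X] has infinite dimension. *)
case: dm dm0 dmk dmX => [r| |]//; rewrite !lee_fin => r0 rk rX.
move: r0; rewrite le_eqVlt => /orP[/eqP <-|r0].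
  by apply: filterE => l; exact: hausdorff_dim_ge0.
(* These exponents tend to [r] while staying positive and below it; being countably many, they share
   one exceptional null set. *)
pose t n := r - r * rad n.+1.
have rn n : 0 < r * rad n.+1 by rewrite mulr_gt0// rad_gt0.
have t0 n : 0 < t n.
  have := @rad_lt R 0 n.+1 isT; rewrite [rad 0]expr0 => rn1.
  by have := ler_wpM2l (ltW r0) rn1; rewrite /t; lra.
have : {ae P, forall l, forall n,
    (0 < hausdorff_measure (t n) (range (fun x : X => proj (l, x))))%E}.
  apply: ae_foralln => n; apply: (@ae_hausdorff_measure_gt0 R Z _ X _ Y _ d L P
    proj _ alpha kappa C) => //; first by have := rn n; rewrite /t; lra.
  apply: (@lt_le_trans _ _ (alpha * r)%:E).
    by rewrite lte_fin ltr_pM2l// /t; have := rn n; lra.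
  by rewrite mulrC EFinM -lee_pdivlMr// -EFinV.
apply: filterS => l lt.
apply/lee_addgt0Pr => e e0.
have [n ne] := @rad_small R (e / r) (divr_gt0 e0 r0).
have tn : ((t n)%:E <= hausdorff_dim (range (fun x : X => proj (l, x))))%E.
  by apply: gt0_hausdorff_measure_dim; [exact: ltW|exact: lt].
apply: (@le_trans _ _ ((t n)%:E + e%:E)%E); last exact: leeD2r.
rewrite -EFinD lee_fin /t.
have : r * rad n.+1 <= e.
  have : rad n.+1 <= e / r by rewrite (le_trans _ (ltW ne))// rad_le.
  by move=> /(ler_wpM2l (ltW r0)); rewrite [leRHS]mulrC divfK// gt_eqF.
lra.
Qed.
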